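(* Let $(M,L)$ be a Dirac manifold, $\iota:N\hookrightarrow M$ an embedded submanifold, and $\nu N$ a normal bundle of $N$ such that $(N,\nu N)$ is a properly normalized submanifold of $(M,L)$. Then $N$ is a proper submanifold of $(M,L)$ and $(N,\nu N,pr_NL)$ is a submersed submanifold of $(M,L)$, and $N$ has the differentiable Dirac structure $$L(N)=\iota^*(L)=pr_NL,$$ where the projection $pr_N$ is defined by the decomposition $T_NM=\nu N\oplus TN$.
   Context: All objects are $C^\infty$. On $TM\oplus T^*M$ consider the pairing $g((X,\alpha),(Y,\beta))=\frac12(\beta(X)+\alpha(Y))$ and the Courant bracket $[(X,\alpha),(Y,\beta)]=([X,Y],\,L_X\beta-L_Y\alpha+\frac12 d(\alpha(Y)-\beta(X)))$. A Dirac structure on $M$ is a maximal $g$-isotropic (rank $\dim M$) subbundle $L\subseteq TM\oplus T^*M$ whose sections are closed under the Courant bracket; a Dirac manifold $(M,L)$ is a manifold with a fixed Dirac structure. Let $\iota:N\hookrightarrow M$ be an embedded submanifold and $T_NM=TM|_N$. The pointwise pullback of $L$ is $$(\iota^*L)_x=\{(Z,\iota^*\alpha)\,:\,Z\in T_xN,\ \alpha\in T^*_xM,\ (Z,\alpha)\in L_x\}\subseteq T_xN\oplus T^*_xN,\quad x\in N,$$ a maximal isotropic subspace at each point, which need not depend differentiably on $x$. $N$ is called a proper submanifold if $\iota^*L$ is a differentiable subbundle of $TN\oplus T^*N$ (it is then a Dirac structure on $N$, called the induced Dirac structure and denoted $L(N)$). A normal bundle of $N$ is a subbundle $\nu N\subseteq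 T_NM$ with $T_NM=\nu N\oplus TN$; the pair $(N,\nu N)$ is a normalized submanifold. Dually $T^*_NM=\nu^*N\oplus T^*N$, with $\nu^*N=ann\,TN$ and $T^*N$ identified with $ann\,\nu N$. Put $$pr_NL=\{(pr_{TN}Z,pr_{T^*N}\alpha)\,:\,(Z,\alpha)\in L|_N\}\subseteq TN\oplus T^*N.$$ If $pr_NL$ is a Dirac structure on $N$, $(N,\nu N,pr_NL)$ is called a submersed submanifold of $(M,L)$. $(N,\nu N)$ is a properly normalized submanifold of $(M,L)$ if $L|_N=L_{\nu N}\oplus L_{TN}$, where $L_{\nu N}=L\cap(\nu N\oplus\nu^*N)$ and $L_{TN}=L\cap(TN\oplus T^*N)$. *)

(* Defs.v *)
(* Dirac geometry over MathComp-Analysis: smooth manifolds given by atlases,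
   the generalized tangent bundle TM (+) T*M, the Courant bracket, Dirac
   structures, and (properly) normalized submanifolds. *)
From mathcomp Require Import all_boot all_order all_algebra.
From mathcomp Require Import all_classical all_reals all_analysis.
Set Implicit Arguments.
Unset Strict Implicit.
Unset Printing Implicit Defensive.
Import Order.TTheory GRing.Theory Num.Theory.
Import numFieldNormedType.Exports.
Local Open Scope classical_set_scope.
Local Open Scope ring_scope.

(* f is C^k on the open set A iff it is differentiable there and all its
   directional derivatives are C^(k-1) on A. *)
Fixpoint Ck_on (R : realType) (V W : normedModType R) (k : nat)
    (A : set V) (f : V -> W) : Prop :=
  match k with
  | 0 => forall x, A x -> {for x, continuous f}
  | k'.+1 => (forall x, A x -> differentiable f x) /\
             (forall v : V, Ck_on k' A ('D_v f))
  end.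

Definition smooth_on (R : realType) (V W : normedModType R)
    (A : set V) (f : V -> W) : Prop := forall k, Ck_on k A f.

(* A homeomorphism from the open set chart_dom onto an open subset of R^n; the
   values of chart_fwd and chart_bwd outside these sets are irrelevant. *)
Record chart (R : realType) (T : topologicalType) (n : nat) := Chart {
  chart_dom : set T ;
  chart_fwd : T -> 'rV[R]_n ;
  chart_bwd : 'rV[R]_n -> T ;
  chart_dom_open : open chart_dom ;
  chart_img_open : open (chart_fwd @` chart_dom) ;
  chart_fwdK : forall x, chart_dom x -> chart_bwd (chart_fwd x) = x ;
  chart_fwd_cont : forall x, chart_dom x -> {for x, continuous chart_fwd} ;
  chart_bwd_cont : forall y, (chart_fwd @` chart_dom) y ->
    {for y, continuous chart_bwd} }.

Record manifold (R : realType) (n : nat) := Manifold {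
  carrier :> topologicalType ;
  atlas : set (chart R carrier n) ;
  atlas_cover : forall x : carrier, exists c, atlas c /\ chart_dom c x ;
  atlas_compat : forall c d, atlas c -> atlas d ->
    smooth_on (chart_fwd c @` (chart_dom c `&` chart_dom d))
              (chart_fwd d \o chart_bwd c) ;
  manifold_hausdorff : hausdorff_space carrier ;
  manifold_second_countable : @second_countable carrier }.

(* A tangent vector at x is a class of pairs (chart at x, vector of R^n) under
   the Jacobians of the transition maps. Each class has exactly one
   representative in the chart chart_at x chosen here, so the fibres T_x M and
   T*_x M are represented by 'rV[R]_n: a vector through its components in
   chart_at x, a covector through its components in the dual basis. *)
Definition chart_at (R : realType) (n : nat) (M : manifold R n) (x : M) :
  chart R M n := projT1 (cid (atlas_cover x)).

Notation fibre R n := ('rV[R]_n * 'rV[R]_n)%type.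

Definition eval_covec (R : realType) (n : nat) (a v : 'rV[R]_n) : R :=
  \sum_i a 0 i * v 0 i.

Section Tangent.
Context {R : realType} {m n : nat} {N : manifold R n} {M : manifold R m}.

Definition smooth_map (f : N -> M) : Prop :=
  continuous f /\
  forall c d, atlas (m := N) c -> atlas (m := M) d ->
    smooth_on (chart_fwd c @` (chart_dom c `&` f @^-1` chart_dom d))
              (chart_fwd d \o f \o chart_bwd c).

(* The tangent map T_x f : T_x N -> T_(f x) M and its transpose *)
Definition tmap (f : N -> M) (x : N) (v : 'rV[R]_n) : 'rV[R]_m :=
  'd (chart_fwd (chart_at (f x)) \o f \o chart_bwd (chart_at x))
     (chart_fwd (chart_at x) x) v.

Definition cotmap (f : N -> M) (x : N) (a : 'rV[R]_m) : 'rV[R]_n :=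
  \row_i eval_covec a (tmap f x (delta_mx 0 i)).

(* A smooth injective immersion that is a homeomorphism onto its image *)
Definition embedding (f : N -> M) : Prop :=
  [/\ smooth_map f,
      forall x, injective (tmap f x),
      injective f &
      forall U : set N, open U -> exists2 V : set M, open V & U = f @^-1` V].

End Tangent.

Section Fields.
Context {R : realType} {m : nat} {M : manifold R m}.

(* Components in the chart d of a tangent vector, resp. covector, at x *)
Definition vec_in (d : chart R M m) (x : M) (v : 'rV[R]_m) : 'rV[R]_m :=
  'd (chart_fwd d \o chart_bwd (chart_at x)) (chart_fwd (chart_at x) x) v.

Definition covec_in (d : chart R M m) (x : M) (a : 'rV[R]_m) : 'rV[R]_m :=
  \row_i eval_covec a
    ('d (chart_fwd (chart_at x) \o chart_bwd d) (chart_fwd d x)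
        (delta_mx 0 i)).

(* Smoothness on the open set U of a section of f^*(TM) *)
Definition smooth_vec_along (n : nat) (N : manifold R n) (f : N -> M)
    (U : set N) (X : N -> 'rV[R]_m) : Prop :=
  forall c d, atlas (m := N) c -> atlas (m := M) d ->
    smooth_on (chart_fwd c @` (U `&` chart_dom c `&` f @^-1` chart_dom d))
              (fun y => vec_in d (f (chart_bwd c y)) (X (chart_bwd c y))).

Definition smooth_vec (U : set M) (X : M -> 'rV[R]_m) : Prop :=
  forall d, atlas (m := M) d ->
    smooth_on (chart_fwd d @` (U `&` chart_dom d))
              (fun y => vec_in d (chart_bwd d y) (X (chart_bwd d y))).

Definition smooth_covec (U : set M) (a : M -> 'rV[R]_m) : Prop :=
  forall d, atlas (m := M) d ->
    smooth_on (chart_fwd d @` (U `&` chart_dom d))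
              (fun y => covec_in d (chart_bwd d y) (a (chart_bwd d y))).

Definition smooth_gen (U : set M) (s : M -> fibre R m) : Prop :=
  smooth_vec U (fun x => (s x).1) /\ smooth_covec U (fun x => (s x).2).

(* Local expressions in chart_at x of a vector field and of a 1-form; at the
   point chart_fwd (chart_at x) x they take the values X x and a x. *)
Definition loc_vec (x : M) (X : M -> 'rV[R]_m) (y : 'rV[R]_m) : 'rV[R]_m :=
  let z := chart_bwd (chart_at x) y in vec_in (chart_at x) z (X z).

Definition loc_covec (x : M) (a : M -> 'rV[R]_m) (y : 'rV[R]_m) : 'rV[R]_m :=
  let z := chart_bwd (chart_at x) y in covec_in (chart_at x) z (a z).

(* [X, Y]^i = X^j d_j Y^i - Y^j d_j X^i *)
Definition lie_bracket (X Y : M -> 'rV[R]_m) (x : M) : 'rV[R]_m :=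
  let p := chart_fwd (chart_at x) x in
  'D_(X x) (loc_vec x Y) p - 'D_(Y x) (loc_vec x X) p.

(* (L_X b)_i = X^j d_j b_i + b_j d_i X^j *)
Definition lie_derivative (X b : M -> 'rV[R]_m) (x : M) : 'rV[R]_m :=
  let p := chart_fwd (chart_at x) x in
  'D_(X x) (loc_covec x b) p
  + \row_i eval_covec (b x) ('D_(delta_mx 0 i) (loc_vec x X) p).

Definition differential (h : M -> R) (x : M) : 'rV[R]_m :=
  \row_i 'D_(delta_mx 0 i) (h \o chart_bwd (chart_at x))
           (chart_fwd (chart_at x) x).

Definition courant (s t : M -> fibre R m) (x : M) : fibre R m :=
  let X z := (s z).1 in let a z := (s z).2 in
  let Y z := (t z).1 in let b z := (t z).2 in
  (lie_bracket X Y x,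
   lie_derivative X b x - lie_derivative Y a x
   + 2^-1 *: differential
       (fun z => eval_covec (a z) (Y z) - eval_covec (b z) (X z)) x).

End Fields.

(* E is a smooth subbundle of rank r of the bundle with typical fibre W over B
   whose smooth sections over an open set U are given by smooth_sec U: it has a
   smooth local frame around every point. *)
Definition subbundle (R : realType) (B : topologicalType) (W : vectType R)
    (smooth_sec : set B -> (B -> W) -> Prop) (r : nat)
    (E : B -> set W) : Prop :=
  forall x : B, exists (U : set B) (s : 'I_r -> B -> W),
    [/\ open U, U x,
        forall i, smooth_sec U (s i) &
        forall y, U y -> free [seq s i y | i <- enum 'I_r] /\
                         E y = [set` <<[seq s i y | i <- enum 'I_r]>>%VS]].

(* S is the internal direct sum of A and B (for linear subspaces) *)
Definition is_dsum (V : zmodType) (S A B : set V) : Prop :=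
  S = [set a + b | a in A & b in B] /\ A `&` B = [set 0].

(* w is the component of v along A with respect to the decomposition A (+) B *)
Definition component (V : zmodType) (A B : set V) (v w : V) : Prop :=
  A w /\ B (v - w).

Section Dirac.
Context {R : realType}.

Definition gpair (m : nat) (p q : fibre R m) : R :=
  2^-1 * (eval_covec q.2 p.1 + eval_covec p.2 q.1).

Definition isotropic (m : nat) (S : set (fibre R m)) : Prop :=
  forall p q, S p -> S q -> gpair p q = 0.

Definition max_isotropic (m : nat) (S : set (fibre R m)) : Prop :=
  isotropic S /\
  forall T : {vspace fibre R m},
    isotropic [set` T] -> S `<=` [set` T] -> [set` T] `<=` S.

(* Closure is required for the sections over arbitrary open sets. *)
Definition courant_closed (m : nat) (M : manifold R m)
    (L : M -> set (fibre R m)) : Prop :=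
  forall (U : set M) (s t : M -> fibre R m),
    open U -> smooth_gen U s -> smooth_gen U t ->
    (forall x, U x -> L x (s x)) -> (forall x, U x -> L x (t x)) ->
    forall x, U x -> L x (courant s t x).

Definition dirac_structure (m : nat) (M : manifold R m)
    (L : M -> set (fibre R m)) : Prop :=
  [/\ subbundle smooth_gen m L,
      forall x, max_isotropic (L x) &
      courant_closed L].

Context {m n : nat} {M : manifold R m} {N : manifold R n}.
Variables (L : M -> set (fibre R m)) (iota : N -> M).

Definition pullback (x : N) : set (fibre R n) :=
  [set q | exists (Z : 'rV[R]_n) (a : 'rV[R]_m),
     L (iota x) (tmap iota x Z, a) /\ q = (Z, cotmap iota x a)].

Definition proper_submanifold : Prop :=
  exists r, subbundle smooth_gen r pullback.

(* T_x N as a subspace of T_(iota x) M, and annihilators *)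
Definition tanN (x : N) : set 'rV[R]_m := range (tmap iota x).

Definition ann (S : set 'rV[R]_m) : set 'rV[R]_m :=
  [set a | forall v, S v -> eval_covec a v = 0].

Variable nu : N -> set 'rV[R]_m.

Definition normal_bundle : Prop :=
  (exists r, subbundle (smooth_vec_along iota) r nu) /\
  forall x, is_dsum setT (nu x) (tanN x).

(* An element q of T_x N (+) T*_x N is identified with the pair (w, b) where
   w = T_x iota q.1 and b is the covector in ann (nu x) restricting to q.2. *)
Definition projected (x : N) : set (fibre R n) :=
  [set q | exists (Z a w b : 'rV[R]_m),
     [/\ L (iota x) (Z, a),
         component (tanN x) (nu x) Z w,
         component (ann (nu x)) (ann (tanN x)) a b,
         w = tmap iota x q.1 &
         q.2 = cotmap iota x b]].

Definition submersed_submanifold : Prop :=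
  normal_bundle /\ dirac_structure projected.

Definition L_nu (x : N) : set (fibre R m) :=
  L (iota x) `&` (nu x `*` ann (tanN x)).

Definition L_tan (x : N) : set (fibre R m) :=
  L (iota x) `&` (tanN x `*` ann (nu x)).

Definition properly_normalized : Prop :=
  normal_bundle /\ forall x, is_dsum (L (iota x)) (L_nu x) (L_tan x).

End Dirac.

(* Main.v *)
From HB Require Import structures.
Require Import Defs.
From mathcomp Require Import all_boot all_order all_algebra.
From mathcomp Require Import all_classical all_reals all_analysis.
From mathcomp Require Import zify.
Set Implicit Arguments.
Unset Strict Implicit.
Unset Printing Implicit Defensive.
Import Order.TTheory GRing.Theory Num.Theory.
Import numFieldNormedType.Exports.
Local Open Scope classical_set_scope.
Local Open Scope ring_scope.

(** At a point x of N, let lift be the map from T_x N (+) T*_x N to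
    T_x M (+) T*_x M sending a vector to its image and a covector to its extension
    by zero on nu x, and let pr be the projection pr_N; then pr after lift is the
    identity, and the two maps are adjoint for the canonical pairings. Proper
    normalization says that lift (pr p) belongs to L whenever p does, and it
    follows that both the pullback and the projection of L consist of the q with
    lift q in L (lemmas pullbackP, projectedP). Since L is its own orthogonal,
    adjointness shows that the pullback is too; so it is maximal isotropic and of
    dimension n (pullback_perp, rank_self_perp).

    Smoothness: the projection of TM along nu onto TN has a smooth matrix
    (smooth_local_projection), so a local frame of L projects to smooth sections
    spanning the pullback, from which n independent ones can be extracted
    (pullback_subbundle).

    Integrability: given sections s and t of the pullback and a point x, their
    lifts are sections of L along N. They need not be extended to M: as the
    Courant bracket depends on 1-jets only, it is enough to have local sections
    S and T of L that agree with the lifts to first order at x, and these are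
    obtained from a frame of L with affine coefficients (extend_section). The
    bracket of S and T lies in L at x, and a computation with 1-jets, whose only
    analytic input is the symmetry of the second derivatives of the embedding
    (hessian_sym), shows that it is related to the bracket of s and t in the way
    that defines the pullback (courant_mem). *)

(** * Calculus of smooth functions on open sets *)

Section LocalDifferential.
Context {R : realType} {V W : normedModType R}.
Implicit Types (f g : V -> W) (A : set V).

Lemma open_near A x (P : V -> Prop) :
  open A -> A x -> (forall y, A y -> P y) -> \forall y \near x, P y.
Proof.
by move=> oA Ax AP; apply: filterS AP _; exact: open_nbhs_nbhs.
Qed.

Lemma near0_differentiable f x :
  (\near x, f x = 0) -> differentiable f x /\ 'd f x = (fun=> 0) :> (V -> W).
Proof.
move=> f0.
have fx0 : f x = 0 by exact: nbhs_singleton f0.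
pose z : {linear V -> W} := \0%R.
have zE : z = (fun=> 0) :> (V -> W) by [].
have zc : continuous z by rewrite zE; exact: cst_continuous.
have E : f \o shift x = cst (f x) + z +o_ (0 : V) id.
  apply/eqaddoP => _/posnumP[e].
  move: f0; rewrite (near_shift 0 x) subr0 => f0.
  near=> y.
  have -> : ((f \o shift x) - (cst (f x) + z)) y = f (y + x) - (f x + 0) by [].
  have -> : f (y + x) = 0 by near: y; exact: f0.
  by rewrite fx0 addr0 subrr normr0 mulr_ge0.
have dz := diff_unique zc E.
split; last by rewrite dz.
by apply/diff_locallyP; rewrite dz.
Unshelve. all: by end_near. Qed.

(** Two functions with the same germ at x differ by a function vanishing near
    x, which is negligible against every increment. *)
Lemma near_eq_diff f g x :
  (\near x, f x = g x) -> differentiable f x ->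
  differentiable g x /\ 'd g x = 'd f x :> (V -> W).
Proof.
move=> fg df.
have [|dh h0] := @near0_differentiable (g - f) x.
  near=> y.
  have fgy : f y = g y by near: y; exact: fg.
  by change (g y - f y = 0); rewrite fgy; exact: subrr.
have gE : g = f + (g - f) by rewrite addrC subrK.
split; first by rewrite gE; exact: differentiableD.
rewrite gE diffD//; apply/funext => v /=.
by rewrite [X in _ + X](congr1 (@^~ v) h0) addr0.
Unshelve. all: by end_near. Qed.

Lemma near_eq_continuous f g x :
  (\near x, f x = g x) -> {for x, continuous f} -> {for x, continuous g}.
Proof.
move=> fg fc; rewrite /prop_for /continuous_at -(nbhs_singleton fg).
by apply: cvg_trans fc; exact: near_eq_cvg.
Qed.

Lemma Ck_on_ext k A f g : open A -> (forall x, A x -> f x = g x) ->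
  Ck_on k A f -> Ck_on k A g.
Proof.
move=> oA; elim: k f g => [|k IH] f g fg /=.
  move=> fc x Ax; apply: near_eq_continuous (fc x Ax).
  exact: open_near oA Ax fg.
move=> [df Df]; split=> [x Ax|v].
  by have [] := near_eq_diff (open_near oA Ax fg) (df x Ax).
apply: IH (Df v) => x Ax; apply: near_eq_derive.
exact: open_near oA Ax fg.
Qed.

Lemma Ck_on_sub k A B f : A `<=` B -> Ck_on k B f -> Ck_on k A f.
Proof.
move=> AB; elim: k f => [|k IH] f /=; first by move=> fc x /AB; exact: fc.
by move=> [df Df]; split=> [x /AB|v]; [exact: df|exact: IH].
Qed.

Lemma Ck_onS k A f : Ck_on k.+1 A f -> Ck_on k A f.
Proof.
elim: k f => [|k IH] f.
  by move=> [df _] x Ax; exact/differentiable_continuous/df.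
by move=> [df Df]; split => // v; exact: IH (Df v).
Qed.

Lemma Ck_on_cst k A (w : W) : Ck_on k A (cst w).
Proof.
elim: k w => [|k IH] w /=; first by move=> x _; exact: cst_continuous.
split=> [x _|v]; first exact: differentiable_cst.
have -> : 'D_v (cst w) = cst 0 by apply/funext => x; rewrite derive_cst.
exact: IH.
Qed.

Lemma Ck_onD k A f g : open A ->
  Ck_on k A f -> Ck_on k A g -> Ck_on k A (fun x => f x + g x).
Proof.
move=> oA; elim: k f g => [|k IH] f g /=.
  by move=> fc gc x Ax; apply: cvgD; [exact: fc|exact: gc].
move=> [df Df] [dg Dg]; split=> [x Ax|v].
  by apply: differentiableD; [exact: df|exact: dg].
apply: Ck_on_ext oA _ (IH _ _ (Df v) (Dg v)) => x Ax.
by rewrite deriveD//; apply: diff_derivable; [exact: df|exact: dg].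
Qed.

Lemma Ck_on_sum k A (I : Type) (r : seq I) (F : I -> V -> W) : open A ->
  (forall i, Ck_on k A (F i)) -> Ck_on k A (fun x => \sum_(i <- r) F i x).
Proof.
move=> oA Fs; elim: r => [|i r IH].
  by apply: (Ck_on_ext oA _ (@Ck_on_cst k A 0)) => x _; rewrite big_nil.
apply: (Ck_on_ext oA _ (Ck_onD oA (Fs i) IH)) => x _; by rewrite big_cons.
Qed.

End LocalDifferential.


Section Scalar.
Context {R : realType} {V W : normedModType R}.
Implicit Types (f g : V -> R) (A : set V).

Lemma Ck_onM k A f g : open A ->
  Ck_on k A f -> Ck_on k A g -> Ck_on k A (fun x => f x * g x).
Proof.
move=> oA; elim: k f g => [|k IH] f g.
  by move=> fc gc x Ax; apply: cvgM; [exact: fc|exact: gc].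
move=> fk gk; have [[df Df] [dg Dg]] := (fk, gk).
split=> [x Ax|v]; first exact: differentiableM (df _ Ax) (dg _ Ax).
apply: (Ck_on_ext oA _ (Ck_onD oA (IH _ _ (Ck_onS fk) (Dg v))
  (IH _ _ (Ck_onS gk) (Df v)))) => x Ax.
by rewrite deriveM//; apply: diff_derivable; [exact: df|exact: dg].
Qed.

(** The derivative - D_v f / f ^ 2 contains no derivative of 1 / f, which is
    what lets the induction on k go through. *)
Lemma Ck_onV k A f : open A -> (forall x, A x -> f x != 0) ->
  Ck_on k A f -> Ck_on k A (fun x => (f x)^-1).
Proof.
move=> oA f0; elim: k => [|k IH].
  by move=> fc x Ax; apply: cvgV; [exact: f0|exact: fc].
move=> fk; have [df Df] := fk.
split=> [x Ax|v]; first exact: differentiableV (df _ Ax) (f0 _ Ax).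
have IHk := IH (Ck_onS fk).
have Dk := Ck_onM oA (Ck_on_cst k A (- 1 : R))
  (Ck_onM oA (Ck_onM oA IHk IHk) (Df v)).
apply: Ck_on_ext oA _ Dk => x Ax.
rewrite deriveV ?f0//; last by apply: diff_derivable; exact: df.
by rewrite /cst mulN1r -invfM -expr2 scaleNr.
Qed.

Lemma Ck_onZl k A f (w : W) : open A ->
  Ck_on k A f -> Ck_on k A (fun x => f x *: w).
Proof.
move=> oA; elim: k f => [|k IH] f.
  move=> fc x Ax; apply: (@continuous_comp _ _ _ f ( *:%R^~ w)); first exact: fc.
  exact: scalel_continuous.
move=> [df Df]; split=> [x Ax|v]; first exact: differentiableZl (df _ Ax).
apply: (Ck_on_ext oA _ (IH _ (Df v))) => x Ax.
rewrite [RHS]deriveE; last exact: differentiableZl (df _ Ax).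
by rewrite diffZl ?deriveE//; exact: df.
Qed.

End Scalar.

Section Matrices.
Context {R : realType} {V : normedModType R}.
Implicit Types (A : set V).

Lemma derive_entry m n (F : V -> 'M[R]_(m, n)) x v i j :
  differentiable F x -> 'D_v F x i j = 'D_v (fun y => F y i j) x.
Proof. by move=> dF; rewrite derive_mx ?mxE//; exact: diff_derivable. Qed.

Lemma differentiable_mxP m n (F : V -> 'M[R]_(m, n)) x :
  differentiable F x <-> forall i j, differentiable (fun y => F y i j) x.
Proof.
split=> [dF i j|dF].
  exact: (differentiable_comp dF (differentiable_coord _ _ _)).
have -> : F = \sum_i \sum_j (fun y => F y i j *: delta_mx i j).
  apply/funext => y; rewrite [LHS]matrix_sum_delta fct_sumE.
  by apply: eq_bigr => i _; rewrite fct_sumE.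
by do 2!apply: differentiable_sum => ?; exact: differentiableZl.
Qed.

Lemma Ck_on_mxP k m n A (F : V -> 'M[R]_(m, n)) : open A ->
  Ck_on k A F <-> forall i j, Ck_on k A (fun y => F y i j).
Proof.
move=> oA; split=> [|Fk].
  elim: k F => [|k IH] F /=.
    move=> Fc i j x Ax.
    apply: (@continuous_comp _ _ _ F (fun M : 'M[R]_(m, n) => M i j)).
      exact: Fc.
    exact: coord_continuous.
  move=> [dF DF] i j; split=> [x Ax|v].
    by have /differentiable_mxP := dF x Ax; exact.
  apply: (Ck_on_ext oA _ (IH _ (DF v) i j)) => x Ax.
  by rewrite derive_entry//; exact: dF.
apply: (Ck_on_ext oA _ (Ck_on_sum _ oA (fun i => Ck_on_sum _ oA
  (fun j => Ck_onZl (delta_mx i j) oA (Fk i j))))) => y _.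
by rewrite [RHS]matrix_sum_delta.
Qed.

End Matrices.

Section Composition.
Context {R : realType}.

(** Induction on k through the chain rule: D_v (g \o f) is the sum over i of
    (D_v f)_i * (D_(e_i) g \o f), and g is generalized so that the induction
    hypothesis applies to the D_(e_i) g. *)
Lemma Ck_on_comp_scalar k (V : normedModType R) m A B
    (f : V -> 'rV[R]_m) (g : 'rV[R]_m -> R) :
  open A -> open B -> (forall x, A x -> B (f x)) ->
  Ck_on k A f -> Ck_on k B g -> Ck_on k A (g \o f).
Proof.
move=> oA oB AB; elim: k g => [|k IH] g.
  move=> fc gc x Ax; apply: continuous_comp; [exact: fc|exact/gc/AB].
move=> fk gk; have [[df Df] [dg Dg]] := (fk, gk).
split=> [x Ax|v].
  by apply: differentiable_comp; [exact: df|exact/dg/AB].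
have Dfk i := (@Ck_on_mxP _ _ k _ _ A ('D_v f) oA).1 (Df v) 0 i.
have Dgk i := IH _ (Ck_onS fk) (Dg (delta_mx 0 i)).
apply: (Ck_on_ext oA _ (Ck_on_sum (index_enum 'I_m) oA
  (fun i => Ck_onM oA (Dfk i) (Dgk i)))) => x Ax.
have dgx := dg _ (AB _ Ax); have dfx := df _ Ax.
rewrite [RHS]deriveE; last exact: differentiable_comp.
rewrite diff_comp//= -(deriveE v dfx).
rewrite [in RHS](matrix_sum_delta ('D_v f x)) big_ord1 linear_sum /=.
by apply: eq_bigr => i _; rewrite linearZ /= -deriveE.
Qed.

End Composition.

Section SmoothMatrices.
Context {R : realType} {V : normedModType R}.
Implicit Types (A : set V).

Lemma smooth_mxP m n A (F : V -> 'M[R]_(m, n)) : open A ->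
  smooth_on A F <-> (forall i j, smooth_on A (fun y => F y i j)).
Proof.
move=> oA; split=> [Fs i j k|Fs k]; first exact: (Ck_on_mxP k F oA).1.
by apply/(Ck_on_mxP k F oA) => i j; exact: Fs.
Qed.

Lemma smooth_on_ext (W : normedModType R) A (f g : V -> W) : open A ->
  (forall x, A x -> f x = g x) -> smooth_on A f -> smooth_on A g.
Proof. by move=> oA fg fs k; exact: Ck_on_ext fg (fs k). Qed.

Lemma smooth_on_sub (W : normedModType R) A B (f : V -> W) :
  A `<=` B -> smooth_on B f -> smooth_on A f.
Proof. by move=> AB fs k; exact: Ck_on_sub AB (fs k). Qed.

Lemma smooth_differentiable (W : normedModType R) A (f : V -> W) x :
  smooth_on A f -> A x -> differentiable f x.
Proof. by move=> /(_ 1%N)[df _]; exact: df. Qed.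

Lemma smooth_cst (W : normedModType R) A (w : W) : smooth_on A (fun=> w).
Proof. by move=> k; exact: Ck_on_cst. Qed.

Lemma smooth_onD (W : normedModType R) A (f g : V -> W) : open A ->
  smooth_on A f -> smooth_on A g -> smooth_on A (fun x => f x + g x).
Proof. by move=> oA fs gs k; exact: Ck_onD. Qed.

Lemma smooth_onM A (f g : V -> R) : open A ->
  smooth_on A f -> smooth_on A g -> smooth_on A (fun x => f x * g x).
Proof. by move=> oA fs gs k; exact: Ck_onM. Qed.

Lemma smooth_on_sum (W : normedModType R) A (I : Type) (r : seq I)
    (F : I -> V -> W) : open A ->
  (forall i, smooth_on A (F i)) -> smooth_on A (fun x => \sum_(i <- r) F i x).
Proof. by move=> oA Fs k; apply: Ck_on_sum => // i; exact: Fs. Qed.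

Lemma smooth_on_prod A (I : Type) (r : seq I) (F : I -> V -> R) : open A ->
  (forall i, smooth_on A (F i)) -> smooth_on A (fun x => \prod_(i <- r) F i x).
Proof.
move=> oA Fs; elim: r => [|i r IH].
  by apply: (smooth_on_ext oA _ (smooth_cst _ (1 : R))) => x _; rewrite big_nil.
by apply: (smooth_on_ext oA _ (smooth_onM oA (Fs i) IH)) => x _; rewrite big_cons.
Qed.

Lemma smooth_mulmx m n p A (F : V -> 'M[R]_(m, n)) (G : V -> 'M[R]_(n, p)) :
  open A -> smooth_on A F -> smooth_on A G ->
  smooth_on A (fun x => F x *m G x).
Proof.
move=> oA /(smooth_mxP _ oA) Fs /(smooth_mxP _ oA) Gs.
apply/(smooth_mxP _ oA) => i j.
apply: (smooth_on_ext oA _ (smooth_on_sum (index_enum 'I_n) oA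
  (fun k => smooth_onM oA (Fs i k) (Gs k j)))) => x _.
by rewrite mxE.
Qed.

Lemma smooth_trmx m n A (F : V -> 'M[R]_(m, n)) : open A ->
  smooth_on A F -> smooth_on A (fun x => (F x)^T).
Proof.
move=> oA /(smooth_mxP _ oA) Fs; apply/(smooth_mxP _ oA) => i j.
by apply: (smooth_on_ext oA _ (Fs j i)) => x _; rewrite mxE.
Qed.

Lemma smooth_det n A (F : V -> 'M[R]_n) : open A ->
  smooth_on A F -> smooth_on A (fun x => \det (F x)).
Proof.
move=> oA /(smooth_mxP _ oA) Fs.
apply: smooth_on_sum => // s; apply: smooth_onM => //; first exact: smooth_cst.
exact: smooth_on_prod.
Qed.

(** By Cramer's rule the entries of the inverse are cofactors divided by the
    determinant, hence rational in the entries. *)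
Lemma smooth_invmx n A (F : V -> 'M[R]_n) : open A ->
  (forall x, A x -> F x \in unitmx) ->
  smooth_on A F -> smooth_on A (fun x => invmx (F x)).
Proof.
move=> oA Fu Fs; have /(smooth_mxP _ oA) Fs' := Fs.
have detV : smooth_on A (fun x => (\det (F x))^-1).
  move=> k; apply: Ck_onV (smooth_det oA Fs k) => // x /Fu.
  by rewrite unitmxE unitfE.
apply/(smooth_mxP _ oA) => i j.
have cof : smooth_on A (fun x => cofactor (F x) j i).
  apply: smooth_onM => //; first exact: smooth_cst.
  apply: smooth_det => //; apply/(smooth_mxP _ oA) => a b.
  by apply: (smooth_on_ext oA _ (Fs' (lift j a) (lift i b))) => x _; rewrite !mxE.
apply: (smooth_on_ext oA _ (smooth_onM oA detV cof)) => x /Fu Fx.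
by rewrite /invmx Fx !mxE.
Qed.

End SmoothMatrices.

Section SmoothMaps.
Context {R : realType}.

Lemma smooth_comp (V : normedModType R) m p q A B
    (f : V -> 'rV[R]_m) (g : 'rV[R]_m -> 'M[R]_(p, q)) :
  open A -> open B -> (forall x, A x -> B (f x)) ->
  smooth_on A f -> smooth_on B g -> smooth_on A (g \o f).
Proof.
move=> oA oB AB fs /(smooth_mxP _ oB) gs; apply/(smooth_mxP _ oA) => i j k.
exact: Ck_on_comp_scalar oA oB AB (fs k) (gs i j k).
Qed.

Lemma smooth_id n (A : set 'rV[R]_n) : smooth_on A id.
Proof.
case=> [|k]; first by move=> x _.
split=> [x _|v]; first by [].
have -> : 'D_v id = cst v by apply/funext => x; rewrite derive_id.
exact: Ck_on_cst.
Qed.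

Lemma smooth_derive (V W : normedModType R) A (f : V -> W) v :
  smooth_on A f -> smooth_on A ('D_v f).
Proof. by move=> fs k; have [_] := fs k.+1; exact. Qed.

Lemma jacobianE n m (f : 'rV[R]_n -> 'rV[R]_m) x i j :
  differentiable f x -> ('J f x) i j = 'D_(delta_mx 0 i) f x 0 j.
Proof. by move=> df; rewrite deriveE// mxE. Qed.

Lemma smooth_jacobian n m A (f : 'rV[R]_n -> 'rV[R]_m) : open A ->
  smooth_on A f -> smooth_on A (jacobian f).
Proof.
move=> oA fs; apply/(smooth_mxP _ oA) => i j.
have /(smooth_mxP _ oA)/(_ 0 j) := smooth_derive (delta_mx 0 i) fs.
apply: smooth_on_ext => // x Ax; rewrite jacobianE//.
exact: smooth_differentiable Ax.
Qed.

Lemma smooth_row_mx (V : normedModType R) m p q A (F : V -> 'M[R]_(m, p))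
    (G : V -> 'M[R]_(m, q)) : open A ->
  smooth_on A F -> smooth_on A G -> smooth_on A (fun x => row_mx (F x) (G x)).
Proof.
move=> oA /(smooth_mxP _ oA) Fs /(smooth_mxP _ oA) Gs.
apply/(smooth_mxP _ oA) => i j; case: (splitP j) => k jk.
  apply: (smooth_on_ext oA _ (Fs i k)) => x _.
  by rewrite (_ : j = lshift q k) ?row_mxEl//; exact: val_inj.
apply: (smooth_on_ext oA _ (Gs i k)) => x _.
by rewrite (_ : j = rshift p k) ?row_mxEr//; exact: val_inj.
Qed.

Lemma unitmx_near (V : normedModType R) m (A : set V) (F : V -> 'M[R]_m) p : open A -> A p ->
  smooth_on A F -> F p \in unitmx ->
  exists B : set V, [/\ open B, B p, B `<=` A &
    forall y, B y -> F y \in unitmx].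
Proof.
move=> oA Ap Fs Fp.
have cD : {for p, continuous (fun y => \det (F y))}.
  by have := smooth_det oA Fs 0%N; exact.
have D0 : \det (F p) != 0 by move: Fp; rewrite unitmxE unitfE.
have nD : \forall y \near p, \det (F y) != 0.
  move: cD => /cvgrPdist_lt/(_ `|\det (F p)|).
  rewrite normr_gt0 => /(_ D0); apply: filterS => z /=.
  by apply: contraTN => /eqP ->; rewrite subr0 ltxx.
have : nbhs p (A `&` [set y | \det (F y) != 0]).
  by apply: filterI; [exact: open_nbhs_nbhs|exact: nD].
rewrite nbhsE => -[B [oB Bp] BP]; exists B; split=> // y /BP[] //.
by move=> _ /=; rewrite unitmxE unitfE.
Qed.

End SmoothMaps.

(** * Symmetry of second derivatives *)

Section Schwarz.
Context {R : realType} {V : normedModType R}.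
Implicit Types (g : V -> R) (A : set V).

Lemma is_derive_line g (a u : V) (s : R) : differentiable g (a + s *: u) ->
  is_derive s 1 (fun s => g (a + s *: u)) ('D_u g (a + s *: u)).
Proof.
move=> dg.
have dl : is_diff s (fun s : R => a + s *: u) (fun h => 0 + h *: u).
  exact: is_diffD.
have df : differentiable (fun s : R => g (a + s *: u)) s.
  exact: (differentiable_comp (@ex_diff _ _ _ _ _ _ _ dl) dg).
split; first exact/diff_derivable.
rewrite deriveE// -[X in 'd X _ _]/(g \o (fun s : R => a + s *: u)).
by rewrite diff_comp//= ?diff_val ?scale1r ?add0r ?deriveE.
Qed.

Lemma MVT_line g (a u : V) (t : R) : 0 < t ->
  (forall s, 0 <= s <= t -> differentiable g (a + s *: u)) ->
  exists2 s, 0 <= s <= t & g (a + t *: u) - g a = 'D_u g (a + s *: u) * t.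
Proof.
move=> t0 dg.
have dl s : 0 <= s <= t ->
    is_derive s 1 (fun s => g (a + s *: u)) ('D_u g (a + s *: u)).
  by move=> st; exact/is_derive_line/dg.
have lc : {within `[0, t], continuous (fun s => g (a + s *: u))}.
  apply: derivable_within_continuous => s; rewrite in_itv /= => st.
  by have [] := dl s st.
have dl' s : s \in `]0, t[%R ->
    is_derive s 1 (fun s => g (a + s *: u)) ('D_u g (a + s *: u)).
  by rewrite in_itv/= => /andP[s0 st]; apply: dl; rewrite (ltW s0) (ltW st).
have [s st E] := MVT_segment (ltW t0) dl' lc.
exists s; first by move: st; rewrite in_itv.
by move: E; rewrite scale0r addr0 subr0.
Qed.

(** The second difference over the parallelogram spanned by t u and t v is
    t ^ 2 times a value of D_v (D_u g) in that parallelogram: apply the mean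
    value theorem along u to the difference along v, then along v to D_u g.
    As the second difference is symmetric in u and v, so is its limit after
    division by t ^ 2. *)
Lemma second_difference A g x u v (e : R) : open A -> A x -> smooth_on A g ->
  0 < e -> exists2 d : R, 0 < d & forall t, 0 < t < d ->
  exists2 c, `|c - 'D_v ('D_u g) x| < e &
    g (x + t *: u + t *: v) - g (x + t *: u) - g (x + t *: v) + g x = c * t * t.
Proof.
move=> oA Ax gs e0.
have dg y : A y -> differentiable g y by exact: smooth_differentiable gs.
have dDg y : A y -> differentiable ('D_u g) y.
  exact: smooth_differentiable (smooth_derive u gs).
have cD : {for x, continuous ('D_v ('D_u g))}.
  by have := smooth_derive v (smooth_derive u gs) 0%N; exact.
have /nbhs_ballP[r /= r0 rP] : \forall y \near x,
    A y /\ `|'D_v ('D_u g) y - 'D_v ('D_u g) x| < e.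
  near=> y; split; first by near: y; exact: open_near oA Ax _.
  rewrite distrC; near: y.
  by move: cD => /cvgrPdist_lt/(_ e e0); exact.
have n0 : 0 < `|u| + `|v| + 1 by rewrite ltr_wpDl ?addr_ge0.
(* this radius keeps the whole parallelogram inside the ball; the summand 1
   avoids a division by zero when u = v = 0 *)
exists (r / (`|u| + `|v| + 1)); first exact: divr_gt0.
move=> t /andP[t0 td].
have inball a b : 0 <= a <= t -> 0 <= b <= t -> ball x r (x + a *: u + b *: v).
  move=> /andP[a0 at_] /andP[b0 bt].
  rewrite -ball_normE /= -addrA opprD addrA subrr sub0r normrN.
  apply: le_lt_trans (ler_normD _ _) _; rewrite !normrZ !ger0_norm//.
  move: td; rewrite ltr_pdivlMr// => /(le_lt_trans _); apply.
  rewrite !mulrDr mulr1 -[leLHS]addr0 lerD ?(ltW t0)//.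
  by rewrite lerD// ler_wpM2r.
have t0t : 0 <= t <= t by rewrite lexx andbT ltW.
have z0t : 0 <= (0 : R) <= t by rewrite lexx ltW.
pose ph := (fun y => g (y + t *: v)) - g.
have dsh y : A (y + t *: v) -> is_diff y (fun y => g (y + t *: v)) ('d g (y + t *: v)).
  move=> Ay.
  have dl : is_diff y (fun y : V => y + t *: v) (id + 0) by exact: is_diffD.
  have dgy := differentiableP (dg _ Ay).
  by apply: is_diff_eq; apply/funext => h /=; rewrite fctE/= addr0.
have Aab a b : 0 <= a <= t -> 0 <= b <= t -> A (x + a *: u + b *: v).
  by move=> ha hb; have [] := rP _ (inball _ _ ha hb).
have Aa a : 0 <= a <= t -> A (x + a *: u).
  by move=> ha; have := Aab _ _ ha z0t; rewrite scale0r addr0.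
have [s|s s01 E1] := @MVT_line ph x u t t0.
  move=> hs; have /dsh ? := Aab _ _ hs t0t; have /dg ? := Aa _ hs.
  by apply: differentiableB.
have Dph : 'D_u ph (x + s *: u) =
    'D_u g (x + s *: u + t *: v) - 'D_u g (x + s *: u).
  have /dsh ds := Aab _ _ s01 t0t; have /dg dgs := Aa _ s01.
  rewrite deriveE; last exact: differentiableB.
  rewrite diffB//= diff_val -!deriveE//.
  exact/dg/Aab.
have [w|w w01 E2] := @MVT_line ('D_u g) (x + s *: u) v t t0.
  by move=> hw; apply/dDg/Aab.
exists ('D_v ('D_u g) (x + s *: u + w *: v)).
  by have [] := rP _ (inball _ _ s01 w01).
rewrite -E2 -Dph -E1 /ph !fctE opprB addrA.
by rewrite addrAC -!addrA; congr (_ + _); rewrite addrCA.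
Unshelve. all: by end_near. Qed.

Let dist_halves (a b c e : R) :
  `|c - a| < e / 2 -> `|c - b| < e / 2 -> `|a - b| <= e.
Proof.
move=> ca cb; rewrite -(subrKA c) [leRHS]splitr.
by apply: le_trans (ler_normD _ _) _; apply: lerD; [rewrite distrC|]; exact: ltW.
Qed.

Lemma schwarz_scalar A g x u v : open A -> A x -> smooth_on A g ->
  'D_v ('D_u g) x = 'D_u ('D_v g) x.
Proof.
move=> oA Ax gs; apply/eqP; rewrite -subr_eq0 -normr_eq0 eq_le normr_ge0 andbT.
apply/ler_addgt0Pr => e e0; rewrite add0r.
have e2 : 0 < e / 2 by rewrite divr_gt0.
have [d d0 dP] := second_difference u v oA Ax gs e2.
have [d' d'0 d'P] := second_difference v u oA Ax gs e2.
pose t := Num.min d d' / 2.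
have m0 : 0 < Num.min d d' by rewrite lt_min d0.
have t0 : 0 < t by rewrite divr_gt0.
have tm : t < Num.min d d' by rewrite ltr_pdivrMr// mulr_natr mulr2n ltrDl.
move: (tm); rewrite lt_min => /andP[td td'].
have [|c c1 cE] := dP t; first by rewrite t0.
have [|c' c1' cE'] := d'P t; first by rewrite t0.
have cc : c = c'.
  apply: (mulIf (lt0r_neq0 t0)); apply: (mulIf (lt0r_neq0 t0)).
  rewrite -cE -cE'. have -> : x + t *: v + t *: u = x + t *: u + t *: v by exact: addrAC.
  by congr (_ + _); exact: addrAC.

by apply: (dist_halves c1); rewrite cc.
Qed.

Lemma schwarz m n A (F : V -> 'M[R]_(m, n)) x u v :
  open A -> A x -> smooth_on A F -> 'D_v ('D_u F) x = 'D_u ('D_v F) x.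
Proof.
move=> oA Ax Fs.
have sD w : smooth_on A ('D_w F) by exact: smooth_derive.
have entry w y : A y -> differentiable ('D_w F) y.
  by move=> Ay; exact: smooth_differentiable (sD w) Ay.
have DE i j w y : A y -> 'D_w F y i j = 'D_w (fun z => F z i j) y.
  by move=> Ay; apply: derive_entry; exact: smooth_differentiable Fs Ay.
apply/matrixP => i j.
have E1 := @derive_entry R V m n ('D_u F) x v i j (entry u x Ax).
have E2 := @derive_entry R V m n ('D_v F) x u i j (entry v x Ax).
apply: (etrans E1); apply: (etrans _ (esym E2)).
have nu : \near x, 'D_u F x i j = 'D_u (fun z => F z i j) x.
  by apply: (open_near oA Ax) => y Ay; exact: DE.
have nv : \near x, 'D_v F x i j = 'D_v (fun z => F z i j) x.
  by apply: (open_near oA Ax) => y Ay; exact: DE.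
apply: (etrans (near_eq_derive v nu)).
apply: (etrans _ (esym (near_eq_derive u nv))).
apply: (schwarz_scalar _ _ oA Ax).
by move: Fs => /(smooth_mxP F oA); exact.
Qed.

End Schwarz.

(** * Frames and the canonical pairing in matrix form *)

Section Frames.
Context {F : fieldType} {vT : vectType F} {d : nat}.
Variable phi : vT -> 'rV[F]_d.
Hypothesis phi_lin : linear phi.
Hypothesis phi_inj : injective phi.

(** The linear injection phi is a parameter because one family of vectors or of
    elements of T_x M (+) T*_x M is read in several charts. *)
Definition coord_mx r (s : 'I_r -> vT) : 'M[F]_(r, d) := \matrix_i phi (s i).

Lemma coord_mx_comb r (s : 'I_r -> vT) (c : 'rV[F]_r) :
  phi (\sum_i c 0 i *: s i) = c *m coord_mx s.
Proof.
pose pM := GRing.isLinear.Build _ _ _ _ _ phi_lin.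
pose pL : {linear vT -> 'rV[F]_d} := HB.pack phi pM.
rewrite -[phi]/(pL : _ -> _) linear_sum mulmx_sum_row.
by apply: eq_bigr => i _; rewrite linearZ /= rowK.
Qed.

Let phi0 : phi 0 = 0.
Proof. by have := phi_lin (-1) 0 0; rewrite scaler0 addr0 scaleN1r addNr. Qed.

Let X r (s : 'I_r -> vT) := [tuple s i | i < r].

Let XE r (s : 'I_r -> vT) (i : 'I_r) : (X s)`_i = s i.
Proof. by rewrite -tnth_nth tnth_mktuple. Qed.

Lemma free_coord_mx r (s : 'I_r -> vT) :
  free [seq s i | i <- enum 'I_r] = row_free (coord_mx s).
Proof.
apply/idP/idP => [/(@freeP _ _ _ (X s)) fs|fs].
  apply/inj_row_free => c c0; apply/rowP => i; rewrite mxE.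
  apply: (fs (fun i => c 0 i)); apply: phi_inj; rewrite phi0.
  by under eq_bigr do rewrite XE; rewrite coord_mx_comb.
apply/(@freeP _ _ _ (X s)) => k k0 i.
have : (\row_j k j) *m coord_mx s = 0.
  rewrite -coord_mx_comb.
  have -> : \sum_i (\row_j k j) 0 i *: s i = \sum_(i < r) k i *: (X s)`_i.
    by apply: eq_bigr => j _; rewrite XE mxE.
  by rewrite k0 phi0.
move/eqP; rewrite mulmx_free_eq0// => /eqP/rowP/(_ i).
by rewrite !mxE.
Qed.

Lemma span_coord_mx r (s : 'I_r -> vT) w :
  (w \in <<[seq s i | i <- enum 'I_r]>>%VS) = (phi w <= coord_mx s)%MS.
Proof.
apply/idP/idP => [ws|/submxP[c E]].
  rewrite (@coord_span _ _ _ (X s) w ws).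
  have -> : \sum_(i < r) coord (X s) i w *: (X s)`_i =
      \sum_i (\row_j coord (X s) j w) 0 i *: s i.
    by apply: eq_bigr => i _; rewrite XE mxE.
  by rewrite coord_mx_comb submxMl.
have -> : w = \sum_i c 0 i *: s i by apply: phi_inj; rewrite coord_mx_comb.
apply: memv_suml => i _; apply: memvZ; apply: memv_span.
by apply/mapP; exists i => //; rewrite mem_enum.
Qed.

End Frames.

Section Pairing.
Context {R : realType}.

Lemma eval_covecE n (a v : 'rV[R]_n) : eval_covec a v = (a *m v^T) 0 0.
Proof. by rewrite mxE; apply: eq_bigr => i _; rewrite mxE. Qed.

Lemma eval_covecC n (a v : 'rV[R]_n) : eval_covec a v = eval_covec v a.
Proof. by apply: eq_bigr => i _; rewrite mulrC. Qed.

Lemma eval_covec_mulmx n p (a : 'rV[R]_n) (v : 'rV[R]_p) (B : 'M[R]_(p, n)) :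
  eval_covec a (v *m B) = eval_covec (a *m B^T) v.
Proof. by rewrite !eval_covecE trmx_mul mulmxA. Qed.

Lemma eval_covecDl n (a b v : 'rV[R]_n) :
  eval_covec (a + b) v = eval_covec a v + eval_covec b v.
Proof. by rewrite !eval_covecE mulmxDl mxE. Qed.

Lemma eval_covecDr n (a v w : 'rV[R]_n) :
  eval_covec a (v + w) = eval_covec a v + eval_covec a w.
Proof. by rewrite !(eval_covecC a) eval_covecDl. Qed.

Lemma eval_covecNr n (a v : 'rV[R]_n) : eval_covec a (- v) = - eval_covec a v.
Proof. by rewrite !eval_covecE raddfN /= mulmxN mxE. Qed.

Lemma eval_covec0r n (a : 'rV[R]_n) : eval_covec a 0 = 0.
Proof. by rewrite eval_covecE trmx0 mulmx0 mxE. Qed.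

Lemma eval_covec_delta n (a : 'rV[R]_n) i : eval_covec a (delta_mx 0 i) = a 0 i.
Proof. by rewrite eval_covecE trmx_delta -colE mxE. Qed.

Lemma row_eval_covec n p (a : 'rV[R]_n) (B : 'M[R]_(p, n)) :
  \row_i eval_covec a (delta_mx 0 i *m B) = a *m B^T.
Proof. by apply/rowP => i; rewrite mxE eval_covec_mulmx eval_covec_delta. Qed.

Definition flat m (p : fibre R m) : 'rV[R]_(m + m) := row_mx p.1 p.2.

Lemma flat_linear m : linear (@flat m).
Proof. by move=> a [u1 u2] [v1 v2]; rewrite /flat scale_row_mx add_row_mx. Qed.

Lemma flat_inj m : injective (@flat m).
Proof. by move=> [u1 u2] [v1 v2] /eq_row_mx[/= -> ->]. Qed.

Lemma row_flat m r (B : 'M[R]_(r, m + m)) i :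
  row i B = flat (lsubmx (row i B), rsubmx (row i B)).
Proof. by rewrite /flat hsubmxK. Qed.

Definition swap_mx m : 'M[R]_(m + m) := block_mx 0 1%:M 1%:M 0.

Lemma swap_mxK m : swap_mx m *m swap_mx m = 1%:M.
Proof.
rewrite mulmx_block !mul0mx !mul1mx !addr0 !add0r.
by rewrite -scalar_mx_block.
Qed.

Lemma gpairE m (p q : fibre R m) :
  gpair p q = 2^-1 * (flat p *m (flat q *m swap_mx m)^T) 0 0.
Proof.
rewrite /gpair /flat mul_row_block !mulmx0 !mulmx1 add0r addr0.
rewrite tr_row_mx mul_row_col mxE !eval_covecE; congr (_ * (_ + _)).
by rewrite -eval_covecE eval_covecC eval_covecE.
Qed.

Lemma gpair_eq0 m (p q : fibre R m) :
  gpair p q = 0 <-> flat p *m (flat q *m swap_mx m)^T = 0.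
Proof.
rewrite gpairE; split=> [/eqP|->]; last by rewrite mxE mulr0.
rewrite mulf_eq0 invr_eq0 pnatr_eq0/= => /eqP E.
by apply/matrixP => i j; rewrite !ord1 E mxE.
Qed.

(** The orthogonal, for the canonical pairing, of the row space of B: swap_mx m
    is the Gram matrix of the pairing up to the factor 1/2. *)
Definition perp_mx m r (B : 'M[R]_(r, m + m)) := kermx (B *m swap_mx m)^T.

Lemma rank_perp_mx m r (B : 'M[R]_(r, m + m)) :
  \rank (perp_mx B) = (m + m - \rank B)%N.
Proof.
rewrite /perp_mx mxrank_ker mxrank_tr mxrankMfree//.
by apply/row_freeP; exists (swap_mx m); exact: swap_mxK.
Qed.

Lemma perp_mxP m r (B : 'M[R]_(r, m + m)) (w : fibre R m) :
  (flat w <= perp_mx B)%MS <->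
  (forall q, (flat q <= B)%MS -> gpair w q = 0).
Proof.
split=> [/sub_kermxP w0 q /submxP[c qE]|h].
  by apply/gpair_eq0; rewrite qE -mulmxA trmx_mul mulmxA w0 mul0mx.
apply/sub_kermxP/trmx_inj; rewrite trmx0 trmx_mul trmxK.
apply/row_matrixP => i; rewrite row_mul row0 row_mul.
rewrite row_flat; apply: trmx_inj; rewrite trmx0 trmx_mul trmxK.
by apply/gpair_eq0; apply: h; rewrite -row_flat row_sub.
Qed.

(** An isotropic subspace E lies in its orthogonal; when E has dimension m the
    orthogonal has dimension 2 m - m, so the two coincide. *)
Lemma isotropic_full_rank m (B : 'M[R]_(m, m + m)) (w : fibre R m) :
  row_free B ->
  (forall p q, (flat p <= B)%MS -> (flat q <= B)%MS -> gpair p q = 0) ->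
  (forall q, (flat q <= B)%MS -> gpair w q = 0) -> (flat w <= B)%MS.
Proof.
move=> fB iso /perp_mxP wB; apply: (submx_trans wB).
have BB : (B <= perp_mx B)%MS.
  apply/row_subP => i.
  rewrite row_flat; apply/perp_mxP => q; apply: iso.
  by rewrite -row_flat row_sub.
rewrite -(geq_leqif (mxrank_leqif_sup BB)) rank_perp_mx.
by move: fB => /eqP ->; rewrite addnK.
Qed.

(** The ranks of B and of its orthogonal add up to 2 m. *)
Lemma rank_self_perp m r (B : 'M[R]_(r, m + m)) :
  (forall w : fibre R m, (flat w <= B)%MS <->
     (forall q, (flat q <= B)%MS -> gpair w q = 0)) ->
  \rank B = m.
Proof.
move=> h.
have E : (B :=: perp_mx B)%MS.
  apply/eqmxP/andP; split; apply/row_subP => i; rewrite row_flat.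
    by apply/perp_mxP; apply/h; rewrite -row_flat row_sub.
  by apply/h/perp_mxP; rewrite -row_flat row_sub.
have := rank_perp_mx B; rewrite -E => rE.
have le : (\rank B <= m + m)%N by exact: rank_leq_col.
have : (\rank B + \rank B = m + m)%N by rewrite {1}rE subnK.
by lia.
Qed.

Lemma max_isotropic_perp m (S : set (fibre R m)) : isotropic S ->
  (forall w, (forall q, S q -> gpair w q = 0) -> S w) -> max_isotropic S.
Proof.
move=> iS h; split=> // T iT ST w Tw; apply: h => q Sq.
exact: iT (ST _ Sq).
Qed.

End Pairing.

Section Projection.
Context {R : realType}.

(** K consists of the last n columns of the inverse of the square matrix with
    block rows E and G; that K is smooth is then Cramer's rule. *)
Lemma smooth_projection (V : normedModType R) k n m (A : set V)
    (E : V -> 'M[R]_(k, m)) (G : V -> 'M[R]_(n, m)) :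
  open A -> smooth_on A E -> smooth_on A G ->
  (forall y, A y -> row_free (col_mx (E y) (G y)) /\
                    row_full (col_mx (E y) (G y))) ->
  exists2 K : V -> 'M[R]_(m, n), smooth_on A K &
    forall y, A y -> E y *m K y = 0 /\ G y *m K y = 1%:M.
Proof.
move=> oA Es Gs EG.
have [[y0 Ay0]|A0] := pselect (exists y, A y); last first.
  (* k + n = m is known only at points of A; if A is empty any K will do *)
  by exists (fun=> 0) => [|y Ay]; [exact: smooth_cst|exfalso; apply: A0; exists y].
have [/eqP r1 /eqP r2] := EG _ Ay0.
have e : (k + n)%N = m by rewrite -r1 r2.
subst m.
pose B y := col_mx (E y) (G y).
have Bs : smooth_on A B.
  apply: (@smooth_on_ext _ _ _ A (fun y => (row_mx (E y)^T (G y)^T)^T)) => //.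
    by move=> y _; rewrite tr_row_mx !trmxK.
  by apply: smooth_trmx => //; apply: smooth_row_mx => //; exact: smooth_trmx.
have Bu y : A y -> B y \in unitmx by move=> /EG[+ _]; rewrite row_free_unit.
have Is := smooth_invmx oA Bu Bs.
exists (fun y => rsubmx (invmx (B y))).
  apply/(smooth_mxP _ oA) => i j.
  have /(smooth_mxP _ oA)/(_ i (rshift k j)) := Is.
  by apply: smooth_on_ext => // y _; rewrite mxE.
move=> y /Bu By; have := mulmxV By.
rewrite -{1}[invmx (B y)]hsubmxK mul_col_row scalar_mx_block.
by move=> /eq_block_mx[_ -> _ ->].
Qed.

End Projection.

(** * First-order jets and the Courant bracket of related sections *)

Section Jets.
Context {R : realType} {V : normedModType R}.

(** The Courant bracket at a point sees only the 1-jets of the sections, so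
    sections on M and on N are compared to first order only. *)
Definition same_jet (W : normedModType R) (p : V) (F H : V -> W) : Prop :=
  [/\ differentiable F p, differentiable H p, F p = H p &
      forall u, 'D_u F p = 'D_u H p].

Lemma same_jet_refl (W : normedModType R) p (F : V -> W) :
  differentiable F p -> same_jet p F F.
Proof. by []. Qed.

Lemma same_jet_sym (W : normedModType R) p (F H : V -> W) :
  same_jet p F H -> same_jet p H F.
Proof. by case=> dF dH E DE; split. Qed.

Lemma same_jet_trans (W : normedModType R) p (F H I : V -> W) :
  same_jet p F H -> same_jet p H I -> same_jet p F I.
Proof.
move=> [dF dH E DE] [_ dI E' DE']; split=> //; first by rewrite E.
by move=> u; exact: etrans (DE u) (DE' u).
Qed.

Lemma same_jet_near (W : normedModType R) p (F H : V -> W) :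
  differentiable F p -> (\forall y \near p, F y = H y) -> same_jet p F H.
Proof.
move=> dF nE; have [dH _] := near_eq_diff nE dF; split=> //.
  exact: nbhs_singleton nE.
by move=> u; exact: near_eq_derive.
Qed.

Lemma differentiable_mulmx m n p q (F : V -> 'M[R]_(m, n)) (H : V -> 'M[R]_(n, q)) :
  differentiable F p -> differentiable H p ->
  differentiable (fun y => F y *m H y) p.
Proof.
move=> /differentiable_mxP dF /differentiable_mxP dH.
apply/differentiable_mxP => i j.
have -> : (fun y => (F y *m H y) i j) =
    \sum_k ((fun y => F y i k) * (fun y => H y k j)).
  by apply/funext => y; rewrite mxE fct_sumE.
by apply: differentiable_sum => k; exact: differentiableM.
Qed.

Lemma derive_mulmx m n p q u (F : V -> 'M[R]_(m, n)) (H : V -> 'M[R]_(n, q)) :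
  differentiable F p -> differentiable H p ->
  'D_u (fun y => F y *m H y) p = 'D_u F p *m H p + F p *m 'D_u H p.
Proof.
move=> dF dH; have dFH := differentiable_mulmx dF dH.
have /differentiable_mxP dF' := dF; have /differentiable_mxP dH' := dH.
apply/matrixP => i j; apply: (etrans (derive_entry u i j dFH)).
have E : (fun y => (F y *m H y) i j) =
    \sum_k ((fun y => F y i k) * (fun y => H y k j)).
  by apply/funext => y; rewrite mxE fct_sumE.
have dk k : derivable ((fun y => F y i k) * (fun y => H y k j)) p u.
  by apply: diff_derivable; exact: differentiableM.
apply: (etrans (congr1 (fun f => 'D_u f p) E)).
apply: (etrans (derive_sum dk)).
rewrite !mxE -big_split /=; apply: eq_bigr => k _.
have dFk := @diff_derivable _ _ _ _ _ u (dF' i k).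
have dHk := @diff_derivable _ _ _ _ _ u (dH' k j).
apply: (etrans (deriveM dFk dHk)).
rewrite -[LHS]/(F p i k * _ + H p k j * _).
have -> := derive_entry u i k dF; have -> := derive_entry u k j dH.
by rewrite addrC [H p k j * _]mulrC.
Qed.

Lemma same_jet_mulmx m n p q (F F' : V -> 'M[R]_(m, n)) (H H' : V -> 'M[R]_(n, q)) :
  same_jet p F F' -> same_jet p H H' ->
  same_jet p (fun y => F y *m H y) (fun y => F' y *m H' y).
Proof.
move=> [dF dF' E DE] [dH dH' E' DE']; split.
- exact: differentiable_mulmx.
- exact: differentiable_mulmx.
- by rewrite E E'.
move=> u; apply: (etrans (derive_mulmx u dF dH)).
apply: (etrans _ (esym (derive_mulmx u dF' dH'))).
by rewrite E E' (DE u) (DE' u).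
Qed.

Lemma same_jet_mxP m n p (F H : V -> 'M[R]_(m, n)) :
  same_jet p F H <-> forall i j, same_jet p (fun y => F y i j) (fun y => H y i j).
Proof.
split=> [[dF dH E DE] i j|h].
  have /differentiable_mxP dF' := dF; have /differentiable_mxP dH' := dH.
  split=> //; first by rewrite E.
  move=> u; apply: (etrans (esym (derive_entry u i j dF))).
  apply: (etrans _ (derive_entry u i j dH)).
  by rewrite (DE u).
have dF : differentiable F p.
  by apply/differentiable_mxP => i j; have [] := h i j.
have dH : differentiable H p.
  by apply/differentiable_mxP => i j; have [] := h i j.
split=> //; first by apply/matrixP => i j; have [] := h i j.
move=> u; apply/matrixP => i j; apply: (etrans (derive_entry u i j dF)).
apply: (etrans _ (esym (derive_entry u i j dH))).
by have [_ _ _] := h i j; exact.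
Qed.

Lemma same_jet_trmx m n p (F H : V -> 'M[R]_(m, n)) :
  same_jet p F H -> same_jet p (fun y => (F y)^T) (fun y => (H y)^T).
Proof.
move=> /same_jet_mxP h; apply/same_jet_mxP => i j.
have E (K : V -> 'M[R]_(m, n)) : (fun y => (K y)^T i j) = (fun y => K y j i).
  by apply/funext => y; rewrite mxE.
by rewrite !E.
Qed.

Lemma same_jet_lsubmx m n1 n2 p (F H : V -> 'M[R]_(m, n1 + n2)) :
  same_jet p F H -> same_jet p (fun y => lsubmx (F y)) (fun y => lsubmx (H y)).
Proof.
move=> /same_jet_mxP h; apply/same_jet_mxP => i j.
have E (K : V -> 'M[R]_(m, n1 + n2)) :
    (fun y => lsubmx (K y) i j) = (fun y => K y i (lshift n2 j)).
  by apply/funext => y; rewrite mxE.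
by rewrite !E.
Qed.

Lemma same_jet_rsubmx m n1 n2 p (F H : V -> 'M[R]_(m, n1 + n2)) :
  same_jet p F H -> same_jet p (fun y => rsubmx (F y)) (fun y => rsubmx (H y)).
Proof.
move=> /same_jet_mxP h; apply/same_jet_mxP => i j.
have E (K : V -> 'M[R]_(m, n1 + n2)) :
    (fun y => rsubmx (K y) i j) = (fun y => K y i (rshift n1 j)).
  by apply/funext => y; rewrite mxE.
by rewrite !E.
Qed.

Lemma same_jetB (W : normedModType R) p (F F' H H' : V -> W) :
  same_jet p F F' -> same_jet p H H' ->
  same_jet p (fun y => F y - H y) (fun y => F' y - H' y).
Proof.
move=> [dF dF' E DE] [dH dH' E' DE'].
split; [exact: differentiableB|exact: differentiableB|by rewrite E E'|].
have B (K I : V -> W) u : differentiable K p -> differentiable I p ->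
    'D_u (fun y => K y - I y) p = 'D_u K p - 'D_u I p.
  by move=> dK dI;
  exact: (@deriveB _ _ _ K I p u (@diff_derivable _ _ _ _ _ u dK)
    (@diff_derivable _ _ _ _ _ u dI)).
move=> u; apply: (etrans (B _ _ u dF dH)).
apply: (etrans _ (esym (B _ _ u dF' dH'))).
by rewrite (DE u) (DE' u).
Qed.

Lemma differentiable_pairing n p (F H : V -> 'rV[R]_n) :
  differentiable F p -> differentiable H p ->
  differentiable (fun y => eval_covec (F y) (H y)) p.
Proof.
move=> dF dH.
have -> : (fun y => eval_covec (F y) (H y)) = (fun y => (F y *m (H y)^T) 0 0).
  by apply/funext => y; exact: eval_covecE.
have [dHT _ _ _] := same_jet_trmx (same_jet_refl dH).
by have /differentiable_mxP := differentiable_mulmx dF dHT; exact.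
Qed.

End Jets.

Section CourantCalculus.
Context {R : realType} {n m : nat}.
Variables (A : set 'rV[R]_n) (p : 'rV[R]_n) (g : 'rV[R]_n -> 'rV[R]_m).
Hypotheses (oA : open A) (Ap : A p) (gs : smooth_on A g).
Local Notation G := (jacobian g).

Let dg : differentiable g p. Proof. exact: smooth_differentiable gs Ap. Qed.

Let dG : differentiable G p.
Proof. exact: smooth_differentiable (smooth_jacobian oA gs) Ap. Qed.

Lemma derive_comp_at (W : normedModType R) (F : 'rV[R]_m -> W) u :
  differentiable F (g p) -> 'D_u (F \o g) p = 'D_(u *m G p) F (g p).
Proof.
move=> dF; have dFg := differentiable_comp dg dF.
apply: (etrans (deriveE u dFg)); apply: (etrans _ (esym (deriveE _ dF))).
apply: (etrans (congr1 (@^~ u) (diff_comp dg dF))) => /=.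
by rewrite /jacobian mul_rV_lin1.
Qed.

(** Schwarz's theorem for g: as v *m G is the derivative of g along v, both
    sides are second derivatives of g along u and v. *)
Lemma hessian_sym (u v : 'rV[R]_n) : v *m 'D_u G p = u *m 'D_v G p.
Proof.
have E w z : w *m 'D_z G p = 'D_z ('D_w g) p.
  have dc : differentiable (fun _ : 'rV[R]_n => w) p by exact: differentiable_cst.
  have := derive_mulmx z dc dG; have -> : 'D_z (fun _ : 'rV[R]_n => w) p = 0.
    exact: derive_cst.
  rewrite mul0mx add0r => <-.
  apply: near_eq_derive; apply: (open_near oA Ap) => y Ay.
  by rewrite deriveEjacobian//; exact: smooth_differentiable gs Ay.
rewrite !E; exact: schwarz oA Ap gs.
Qed.

(** Differentiating the relation between A' and X (resp. B and Y) produces the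
    terms Y *m D_X G and X *m D_Y G, which cancel by symmetry of the Hessian. *)
Lemma related_bracket (X Y : 'rV[R]_n -> 'rV[R]_n) (A' B : 'rV[R]_m -> 'rV[R]_m) :
  differentiable X p -> differentiable Y p ->
  differentiable A' (g p) -> differentiable B (g p) ->
  same_jet p (A' \o g) (fun y => X y *m G y) ->
  same_jet p (B \o g) (fun y => Y y *m G y) ->
  ('D_(X p) Y p - 'D_(Y p) X p) *m G p =
  'D_(A' (g p)) B (g p) - 'D_(B (g p)) A' (g p).
Proof.
move=> dX dY dA dB [_ _ EA DA] [_ _ EB DB].
have -> : A' (g p) = X p *m G p by exact: EA.
have -> : B (g p) = Y p *m G p by exact: EB.
have h1 : 'D_(X p *m G p) B (g p) = 'D_(X p) Y p *m G p + Y p *m 'D_(X p) G p.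
  apply: (etrans (esym (derive_comp_at (X p) dB))); apply: (etrans (DB _)).
  exact: derive_mulmx.
have h2 : 'D_(Y p *m G p) A' (g p) = 'D_(Y p) X p *m G p + X p *m 'D_(Y p) G p.
  apply: (etrans (esym (derive_comp_at (Y p) dA))); apply: (etrans (DA _)).
  exact: derive_mulmx.
rewrite h1 h2 (hessian_sym (X p) (Y p)) mulmxBl.
by rewrite opprD addrACA subrr addr0.
Qed.

Lemma row_derive k (b : 'rV[R]_k) (F : 'rV[R]_k -> 'rV[R]_k) q :
  differentiable F q ->
  \row_i eval_covec b ('D_(delta_mx 0 i) F q) = b *m ('J F q)^T.
Proof.
move=> dF; rewrite -row_eval_covec; apply/rowP => i; rewrite !mxE.
by rewrite deriveEjacobian.
Qed.

(** Here too the derivatives of G appearing in b and in X compensate each other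
    by symmetry of the Hessian, once the transposes are moved to the same
    side. *)
Lemma related_lie_derivative (X b : 'rV[R]_n -> 'rV[R]_n)
    (A' be : 'rV[R]_m -> 'rV[R]_m) :
  differentiable X p -> differentiable A' (g p) -> differentiable be (g p) ->
  same_jet p (A' \o g) (fun y => X y *m G y) ->
  same_jet p b (fun y => be (g y) *m (G y)^T) ->
  'D_(X p) b p + \row_i eval_covec (b p) ('D_(delta_mx 0 i) X p) =
  ('D_(A' (g p)) be (g p) +
   \row_i eval_covec (be (g p)) ('D_(delta_mx 0 i) A' (g p))) *m (G p)^T.
Proof.
move=> dX dA dbe [_ dXG EA DA] [db _ Eb Db].
have -> : A' (g p) = X p *m G p by exact: EA.
rewrite !row_derive// mulmxDl.
have dbeg : differentiable (be \o g) p by exact: differentiable_comp.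
have dGT : differentiable (fun y => (G y)^T) p.
  by have [] := same_jet_trmx (same_jet_refl dG).
have DGT u : 'D_u (fun y => (G y)^T) p = ('D_u G p)^T.
  apply/matrixP => i j; apply: (etrans (derive_entry u i j dGT)).
  rewrite mxE; apply: (etrans _ (esym (derive_entry u j i dG))).
  apply: (congr1 (fun f => 'D_u f p)).
  by apply/funext => y; rewrite mxE.
have h1 : 'D_(X p) b p =
    'D_(X p *m G p) be (g p) *m (G p)^T + be (g p) *m ('D_(X p) G p)^T.
  apply: (etrans (Db _)); apply: (etrans (derive_mulmx (X p) dbeg dGT)).
  by have -> := DGT (X p); have -> := derive_comp_at (X p) dbe.
rewrite h1 -addrA; congr (_ + _).
rewrite Eb -!mulmxA -mulmxDr; congr (_ *m _).
rewrite -!trmx_mul -raddfD /=; congr trmx.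
apply/row_matrixP => i; rewrite !rowE mulmxDr !mulmxA.
rewrite (hessian_sym (X p) (delta_mx 0 i)).
have <- := deriveEjacobian (delta_mx 0 i) dX.
have <- := deriveEjacobian (delta_mx 0 i *m G p) dA.
apply: (etrans _ (derive_comp_at (delta_mx 0 i) dA)).
apply: (etrans _ (esym (DA (delta_mx 0 i)))).
by apply: (etrans _ (esym (derive_mulmx (delta_mx 0 i) dX dG))); rewrite addrC.
Qed.

Lemma related_differential (h : 'rV[R]_n -> R) (k : 'rV[R]_m -> R) :
  differentiable k (g p) -> same_jet p h (k \o g) ->
  \row_i 'D_(delta_mx 0 i) h p = (\row_j 'D_(delta_mx 0 j) k (g p)) *m (G p)^T.
Proof.
move=> dk [dh _ _ Dh]; rewrite -row_eval_covec; apply/rowP => i; rewrite !mxE.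
apply: (etrans (Dh (delta_mx 0 i))).
apply: (etrans (derive_comp_at (delta_mx 0 i) dk)).
apply: (etrans (deriveE _ dk)).
rewrite [in LHS](row_sum_delta (delta_mx 0 i *m G p)) linear_sum.
rewrite eval_covecC /eval_covec; apply: eq_bigr => j _.
by rewrite linearZ /= mxE deriveE.
Qed.

(** The Jacobian of g moves across the pairing as a transpose, so it may be
    attached either to be or to Y. *)
Lemma related_pairing (b Y : 'rV[R]_n -> 'rV[R]_n) (be B : 'rV[R]_m -> 'rV[R]_m) :
  differentiable Y p ->
  differentiable be (g p) ->
  same_jet p (B \o g) (fun y => Y y *m G y) ->
  same_jet p b (fun y => be (g y) *m (G y)^T) ->
  same_jet p (fun y => eval_covec (b y) (Y y))
    (fun y => eval_covec (be (g y)) (B (g y))).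
Proof.
move=> dY dbe jB jb.
have E k (f h : 'rV[R]_n -> 'rV[R]_k) : (fun y => eval_covec (f y) (h y)) =
    (fun y => (f y *m (h y)^T) 0 0).
  by apply/funext => y; exact: eval_covecE.
rewrite !E.
have dbeg : differentiable (be \o g) p by exact: differentiable_comp.
have j1 := same_jet_mulmx jb (same_jet_trmx (same_jet_refl dY)).
have j2 := same_jet_mulmx (same_jet_refl dbeg) (same_jet_trmx (same_jet_sym jB)).
have j3 : same_jet p (fun y => b y *m (Y y)^T) (fun y => be (g y) *m (B (g y))^T).
  apply: same_jet_trans j1 _.
  have -> : (fun y => be (g y) *m (G y)^T *m (Y y)^T) =
      (fun y => (be \o g) y *m (Y y *m G y)^T).
    by apply/funext => y; rewrite trmx_mul mulmxA.
  exact: j2.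
by move: j3 => /same_jet_mxP; exact.
Qed.

End CourantCalculus.

(** * Tangent maps and changes of charts *)

Section ChartImages.
Context {R : realType} {T : topologicalType} {n : nat}.
Implicit Types (c : chart R T n) (U : set T).

Lemma chart_img_nbhs_open c U : open U ->
  open (chart_fwd c @` (U `&` chart_dom c)).
Proof.
move=> oU; rewrite openE => _ [x [Ux cx] <-].
have Ic : (chart_fwd c @` chart_dom c) (chart_fwd c x) by exists x.
have nI := open_nbhs_nbhs (conj (@chart_img_open _ _ _ c) Ic).
have nU : \forall y \near chart_fwd c x, U (chart_bwd c y).
  apply: (chart_bwd_cont Ic).
  by apply: open_nbhs_nbhs; rewrite chart_fwdK.
apply: filterS2 nI nU => _ [z cz <-]; rewrite chart_fwdK// => Uz.
by exists z.
Qed.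

Lemma chart_preimage_fwd_open c (B : set 'rV[R]_n) : open B ->
  open (chart_dom c `&` chart_fwd c @^-1` B).
Proof.
move=> oB; rewrite openE => x [cx Bx]; apply: filterI.
  by apply: open_nbhs_nbhs; split; first exact: chart_dom_open.
by apply: (chart_fwd_cont cx); exact: open_nbhs_nbhs.
Qed.

Lemma chart_img_open_sub c U : open U -> U `<=` chart_dom c ->
  open (chart_fwd c @` U).
Proof. by move=> oU /setIidl <-; exact: chart_img_nbhs_open. Qed.

End ChartImages.

Section ChartAt.
Context {R : realType} {n : nat} {M : manifold R n}.

Lemma chart_at_atlas (x : M) : atlas (m := M) (chart_at x).
Proof. by rewrite /chart_at; case: cid => c /= []. Qed.

Lemma chart_at_dom (x : M) : chart_dom (chart_at x) x.
Proof. by rewrite /chart_at; case: cid => c /= []. Qed.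

Lemma smooth_map_id : smooth_map (@id M).
Proof. by split=> [x|c d hc hd]; [exact: cvg_id|exact: atlas_compat]. Qed.

End ChartAt.

(** Vectors are rows: this matrix acts on them on the right, and its transpose
    pulls back covectors. With f the identity it is a change of charts. *)
Definition tangent_mx (R : realType) (n m : nat) (N : manifold R n)
    (M : manifold R m) (f : N -> M) (c : chart R N n) (d : chart R M m) (x : N) :
  'M[R]_(n, m) := 'J (chart_fwd d \o f \o chart_bwd c) (chart_fwd c x).

Section TangentMx.
Context {R : realType} {n m : nat} {N : manifold R n} {M : manifold R m}.
Variables (f : N -> M) (c : chart R N n) (d : chart R M m).
Hypotheses (sf : smooth_map f) (ac : atlas (m := N) c) (ad : atlas (m := M) d).

Lemma chart_preimage_open : open (chart_dom c `&` f @^-1` chart_dom d).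
Proof.
apply: openI; first exact: chart_dom_open.
by have [/continuousP fc _] := sf; apply: fc; exact: chart_dom_open.
Qed.

Lemma loc_differentiable x : chart_dom c x -> chart_dom d (f x) ->
  differentiable (chart_fwd d \o f \o chart_bwd c) (chart_fwd c x).
Proof.
move=> cx dx; have [_ /(_ _ _ ac ad) sm] := sf.
by apply: smooth_differentiable sm _; exists x.
Qed.

Lemma smooth_loc (U : set N) : U `<=` chart_dom c ->
  (forall x, U x -> chart_dom d (f x)) ->
  smooth_on (chart_fwd c @` U) (chart_fwd d \o f \o chart_bwd c).
Proof.
move=> Uc Ud; have [_ /(_ _ _ ac ad) sm] := sf.
by apply: smooth_on_sub sm => _ [x Ux <-]; exists x => //; split; [exact: Uc|exact: Ud].
Qed.

End TangentMx.

Section TangentComp.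
Context {R : realType} {n m p : nat} {N : manifold R n} {M : manifold R m}
  {P : manifold R p}.

(** The chain rule, the intermediate chart d cancelling near x. Taking f or h to
    be the identity yields all the change of chart formulas below. *)
Lemma tangent_mx_comp (f : N -> M) (h : M -> P) c d e x :
  smooth_map f -> smooth_map h ->
  atlas (m := N) c -> atlas (m := M) d -> atlas (m := P) e ->
  chart_dom c x -> chart_dom d (f x) -> chart_dom e (h (f x)) ->
  tangent_mx f c d x *m tangent_mx h d e (f x) = tangent_mx (h \o f) c e x.
Proof.
move=> sf sh ac ad ae cx dx ex.
have df := loc_differentiable sf ac ad cx dx.
have dh := loc_differentiable sh ad ae dx ex.
pose F := chart_fwd d \o f \o chart_bwd c.
pose H := chart_fwd e \o h \o chart_bwd d.
have FE : F (chart_fwd c x) = chart_fwd d (f x) by rewrite /F/= chart_fwdK.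
have nE : \forall y \near chart_fwd c x,
    (H \o F) y = (chart_fwd e \o (h \o f) \o chart_bwd c) y.
  apply: (@open_near _ _ (chart_fwd c @` (chart_dom c `&` f @^-1` chart_dom d))).
  - apply: chart_img_open_sub; last by move=> ? [].
    exact: chart_preimage_open.
  - by exists x.
  - by move=> _ [z [cz dz] <-]; rewrite /F /H /= !chart_fwdK.
rewrite -FE in dh.
have [_ dE] := near_eq_diff nE (differentiable_comp df dh).
apply/row_matrixP => i; rewrite !rowE mulmxA !mul_rV_lin1 /=.
apply: (etrans _ (esym (congr1 (@^~ _) dE))).
apply: (etrans _ (esym (congr1 (@^~ _) (diff_comp df dh)))).
by rewrite -FE.
Qed.

End TangentComp.

Section Transitions.
Context {R : realType} {n : nat} {M : manifold R n}.
Implicit Types (c d e : chart R M n) (x : M).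

Lemma transition_comp c d e x :
  atlas (m := M) c -> atlas (m := M) d -> atlas (m := M) e ->
  chart_dom c x -> chart_dom d x -> chart_dom e x ->
  tangent_mx id c d x *m tangent_mx id d e x = tangent_mx id c e x.
Proof.
by move=> ac ad ae cx dx ex; apply: tangent_mx_comp; try exact: smooth_map_id.
Qed.

Lemma transition_id c x : chart_dom c x -> tangent_mx id c c x = 1%:M.
Proof.
move=> cx.
have nE : \forall y \near chart_fwd c x,
    id y = (chart_fwd c \o id \o chart_bwd c) y.
  apply: (open_near (@chart_img_open _ _ _ c)); first by exists x.
  by move=> _ [z cz <-] /=; rewrite chart_fwdK.
have [_ dE] := near_eq_diff nE (ex_diff : differentiable id (chart_fwd c x)).
apply/row_matrixP => i; rewrite !rowE mul_rV_lin1 /= mulmx1.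
apply: (etrans (congr1 (@^~ _) dE)).
by rewrite diff_val.
Qed.

Lemma transitionK c d x : atlas (m := M) c -> atlas (m := M) d ->
  chart_dom c x -> chart_dom d x ->
  tangent_mx id c d x *m tangent_mx id d c x = 1%:M.
Proof. by move=> ac ad cx dx; rewrite transition_comp// transition_id. Qed.

Lemma vec_inE d x v : vec_in d x v = v *m tangent_mx id (chart_at x) d x.
Proof. by rewrite /tangent_mx /jacobian mul_rV_lin1. Qed.

Lemma covec_inE d x a : covec_in d x a = a *m (tangent_mx id d (chart_at x) x)^T.
Proof.
rewrite -row_eval_covec; apply/rowP => i; rewrite !mxE; congr eval_covec.
by rewrite /tangent_mx /jacobian mul_rV_lin1.
Qed.

Lemma vec_in_chart_at x v : vec_in (chart_at x) x v = v.
Proof. by rewrite vec_inE transition_id ?mulmx1//; exact: chart_at_dom. Qed.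

Lemma covec_in_chart_at x a : covec_in (chart_at x) x a = a.
Proof.
by rewrite covec_inE transition_id ?trmx1 ?mulmx1//; exact: chart_at_dom.
Qed.

Lemma vec_in_transition c d x v : atlas (m := M) c -> atlas (m := M) d ->
  chart_dom c x -> chart_dom d x ->
  vec_in d x v = vec_in c x v *m tangent_mx id c d x.
Proof.
move=> ac ad cx dx; rewrite !vec_inE -mulmxA transition_comp//.
- exact: chart_at_atlas.
- exact: chart_at_dom.
Qed.

Lemma covec_in_transition c d x a : atlas (m := M) c -> atlas (m := M) d ->
  chart_dom c x -> chart_dom d x ->
  covec_in d x a = covec_in c x a *m (tangent_mx id d c x)^T.
Proof.
move=> ac ad cx dx; rewrite !covec_inE -mulmxA -trmx_mul transition_comp//.
- exact: chart_at_atlas.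
- exact: chart_at_dom.
Qed.

Lemma eval_covec_in d x a v : atlas (m := M) d -> chart_dom d x ->
  eval_covec (covec_in d x a) (vec_in d x v) = eval_covec a v.
Proof.
move=> ad dx; rewrite vec_inE eval_covec_mulmx covec_inE -mulmxA -trmx_mul.
rewrite transitionK ?trmx1 ?mulmx1//; [exact: chart_at_atlas|exact: chart_at_dom].
Qed.

Lemma vec_in_linear d x : linear (vec_in d x).
Proof. by move=> a u v; rewrite !vec_inE mulmxDl scalemxAl. Qed.

Lemma covec_in_linear d x : linear (covec_in d x).
Proof. by move=> a u v; rewrite !covec_inE mulmxDl scalemxAl. Qed.

Lemma vec_in_inj d x : atlas (m := M) d -> chart_dom d x ->
  injective (vec_in d x).
Proof.
move=> ad dx; apply: (can_inj (g := mulmxr (tangent_mx id d (chart_at x) x))).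
move=> v; rewrite vec_inE /= -mulmxA transitionK ?mulmx1//.
- exact: chart_at_atlas.
- exact: chart_at_dom.
Qed.

Lemma covec_in_inj d x : atlas (m := M) d -> chart_dom d x ->
  injective (covec_in d x).
Proof.
move=> ad dx; apply: (can_inj (g := mulmxr (tangent_mx id (chart_at x) d x)^T)).
move=> v; rewrite covec_inE /= -mulmxA -trmx_mul transitionK ?trmx1 ?mulmx1//.
- exact: chart_at_atlas.
- exact: chart_at_dom.
Qed.

Definition gen_in d x (p : fibre R n) : 'rV[R]_(n + n) :=
  row_mx (vec_in d x p.1) (covec_in d x p.2).

Lemma gen_in_linear d x : linear (gen_in d x).
Proof.
move=> a [u1 u2] [v1 v2]; rewrite /gen_in /= vec_in_linear covec_in_linear.
by rewrite scale_row_mx add_row_mx.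
Qed.

Lemma gen_in_inj d x : atlas (m := M) d -> chart_dom d x ->
  injective (gen_in d x).
Proof.
move=> ad dx [u1 u2] [v1 v2] /eq_row_mx[/= h1 h2].
by rewrite (vec_in_inj ad dx h1) (covec_in_inj ad dx h2).
Qed.

(** In another chart the components are multiplied by the Jacobian of the
    transition map and composed with its inverse, and both are smooth. *)
Lemma smooth_vec_chart (U : set M) c X : open U -> U `<=` chart_dom c ->
  atlas (m := M) c ->
  smooth_on (chart_fwd c @` U)
    (fun y => vec_in c (chart_bwd c y) (X (chart_bwd c y))) ->
  smooth_vec U X.
Proof.
move=> oU Uc ac sX d ad.
have oB := @chart_img_nbhs_open _ _ _ d _ oU.
have oA := chart_img_open_sub oU Uc.
pose T := chart_fwd c \o id \o chart_bwd d.
have sT : smooth_on (chart_fwd d @` (U `&` chart_dom d)) T.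
  by apply: (smooth_loc (@smooth_map_id _ _ M) ad ac) => x [] => [?|/Uc].
have oA' : open (chart_fwd c @` (U `&` chart_dom d)).
  apply: chart_img_open_sub; last by move=> x [/Uc].
  by apply: openI => //; exact: chart_dom_open.
pose J := jacobian (chart_fwd d \o id \o chart_bwd c).
have sJ : smooth_on (chart_fwd c @` (U `&` chart_dom d)) J.
  apply: smooth_jacobian => //.
  by apply: (smooth_loc (@smooth_map_id _ _ M) ac ad) => x [] => [/Uc|].
have sXJ : smooth_on (chart_fwd c @` (U `&` chart_dom d))
    (fun y => vec_in c (chart_bwd c y) (X (chart_bwd c y)) *m J y).
  apply: smooth_mulmx => //; apply: smooth_on_sub sX.
  by move=> _ [x [Ux _] <-]; exists x.
apply: (smooth_on_ext oB _ (smooth_comp oB oA' _ sT sXJ)).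
  move=> _ [x [Ux dx] <-]; rewrite /T /= (chart_fwdK dx) (chart_fwdK (Uc _ Ux)).
  by rewrite (@vec_in_transition c d)//; exact: Uc.
by move=> _ [x [Ux dx] <-]; exists x => //; rewrite /T /= chart_fwdK.
Qed.

Lemma smooth_covec_chart (U : set M) c a : open U -> U `<=` chart_dom c ->
  atlas (m := M) c ->
  smooth_on (chart_fwd c @` U)
    (fun y => covec_in c (chart_bwd c y) (a (chart_bwd c y))) ->
  smooth_covec U a.
Proof.
move=> oU Uc ac sa d ad.
have oB := @chart_img_nbhs_open _ _ _ d _ oU.
have oA := chart_img_open_sub oU Uc.
pose T := chart_fwd c \o id \o chart_bwd d.
have sT : smooth_on (chart_fwd d @` (U `&` chart_dom d)) T.
  by apply: (smooth_loc (@smooth_map_id _ _ M) ad ac) => x [] => [?|/Uc].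
have TA y : (chart_fwd d @` (U `&` chart_dom d)) y -> (chart_fwd c @` U) (T y).
  by move=> [x [Ux dx] <-]; exists x => //; rewrite /T /= chart_fwdK.
have := smooth_mulmx oB (smooth_comp oB oA TA sT sa)
  (smooth_trmx oB (smooth_jacobian oB sT)).
apply: smooth_on_ext => // _ [x [Ux dx] <-].
rewrite /= /T/= (chart_fwdK dx) (chart_fwdK (Uc _ Ux)).
by rewrite (@covec_in_transition c d)//; exact: Uc.
Qed.

End Transitions.

Section TangentMapInCharts.
Context {R : realType} {n m : nat} {N : manifold R n} {M : manifold R m}.
Variables (f : N -> M) (sf : smooth_map f).
Implicit Types (c : chart R N n) (d : chart R M m) (x : N).

Lemma tmapE x v :
  tmap f x v = v *m tangent_mx f (chart_at x) (chart_at (f x)) x.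
Proof. by rewrite /tangent_mx /jacobian mul_rV_lin1. Qed.

Lemma cotmapE x a :
  cotmap f x a = a *m (tangent_mx f (chart_at x) (chart_at (f x)) x)^T.
Proof.
rewrite -row_eval_covec; apply/rowP => i; rewrite !mxE; congr eval_covec.
by rewrite tmapE.
Qed.

Lemma tangent_mx_src c c' d x : atlas (m := N) c -> atlas (m := N) c' ->
  atlas (m := M) d -> chart_dom c x -> chart_dom c' x -> chart_dom d (f x) ->
  tangent_mx id c c' x *m tangent_mx f c' d x = tangent_mx f c d x.
Proof.
by move=> *; apply: (@tangent_mx_comp _ _ _ _ N N M id f) => //; exact: smooth_map_id.
Qed.

Lemma tangent_mx_tgt c d d' x : atlas (m := N) c -> atlas (m := M) d ->
  atlas (m := M) d' -> chart_dom c x -> chart_dom d (f x) -> chart_dom d' (f x) ->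
  tangent_mx f c d x *m tangent_mx id d d' (f x) = tangent_mx f c d' x.
Proof.
by move=> *; apply: (@tangent_mx_comp _ _ _ _ N M M f id) => //; exact: smooth_map_id.
Qed.

Lemma vec_in_tmap c d x v : atlas (m := N) c -> atlas (m := M) d ->
  chart_dom c x -> chart_dom d (f x) ->
  vec_in d (f x) (tmap f x v) = vec_in c x v *m tangent_mx f c d x.
Proof.
move=> ac ad cx dx; rewrite vec_inE tmapE vec_inE -!mulmxA.
rewrite tangent_mx_tgt ?tangent_mx_src//;
  by [exact: chart_at_atlas|exact: chart_at_dom].
Qed.

Lemma covec_in_cotmap c d x a : atlas (m := N) c -> atlas (m := M) d ->
  chart_dom c x -> chart_dom d (f x) ->
  covec_in c x (cotmap f x a) = covec_in d (f x) a *m (tangent_mx f c d x)^T.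
Proof.
move=> ac ad cx dx; rewrite covec_inE cotmapE covec_inE -!mulmxA -!trmx_mul.
rewrite tangent_mx_tgt ?tangent_mx_src//;
  by [exact: chart_at_atlas|exact: chart_at_dom].
Qed.

End TangentMapInCharts.

(** * Properly normalized submanifolds at a point *)

Section Pointwise.
Context {R : realType} {m n : nat} {M : manifold R m} {N : manifold R n}.
Variables (L : M -> set (fibre R m)) (iota : N -> M) (nu : N -> set 'rV[R]_m).
Variable x : N.

Definition tmap_mx : 'M[R]_(n, m) :=
  tangent_mx iota (chart_at x) (chart_at (iota x)) x.
Local Notation G := tmap_mx.

(** K is the projection of T_x M onto T_x N along nu x, with values expressed in
    T_x N rather than in its image under tmap. *)
Definition tangent_projection (K : 'M[R]_(m, n)) : Prop :=
  G *m K = 1%:M /\ forall v, nu x v -> v *m K = 0.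

Variable K : 'M[R]_(m, n).
Hypothesis KP : tangent_projection K.
Hypothesis split_TM : is_dsum setT (nu x) (Defs.tanN iota x).

(** lift_gen identifies T_x N (+) T*_x N with the subspace of T_x M (+) T*_x M
    formed of the range of tmap and the annihilator of nu x; proj_gen is the
    projection pr_N composed with the inverse identification. *)
Definition lift_gen (q : fibre R n) : fibre R m := (q.1 *m G, q.2 *m K^T).
Definition proj_gen (p : fibre R m) : fibre R n := (p.1 *m K, p.2 *m G^T).

Lemma nu_complement v : nu x (v - v *m K *m G).
Proof.
have [GK nuK] := KP; have [E _] := split_TM.
have : [set: 'rV[R]_m] v by [].
rewrite E => -[a na [_ [w _ <-] <-]].
rewrite tmapE -/G mulmxDl nuK// add0r -[w *m G *m K]mulmxA GK mulmx1.
by rewrite addrK.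
Qed.

Lemma nu0 : nu x 0.
Proof.
have [_ E] := split_TM; have : [set (0 : 'rV[R]_m)] 0 by [].
by rewrite -E => -[].
Qed.

Lemma ann_tanNP a : ann (Defs.tanN iota x) a <-> a *m G^T = 0.
Proof.
split=> [an|a0 _ [w _ <-]].
  apply/rowP => i; rewrite -row_eval_covec !mxE; apply: an.
  by exists (delta_mx 0 i) => //; rewrite tmapE.
by rewrite tmapE eval_covec_mulmx a0 eval_covecC eval_covec0r.
Qed.

(** A covector killing nu x is determined by its restriction to T_x N, because
    v - v *m K *m G belongs to nu x. *)
Lemma ann_nuP a : ann (nu x) a <-> a = a *m G^T *m K^T.
Proof.
have [GK nuK] := KP; split=> [an|-> v nv].
  rewrite -mulmxA -trmx_mul -row_eval_covec; apply/rowP => i.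
  rewrite !mxE -eval_covec_delta; apply/eqP; rewrite -subr_eq0; apply/eqP.
  rewrite -[RHS](an _ (nu_complement (delta_mx 0 i))) mulmxA.
  by rewrite eval_covecDr eval_covecNr.
by rewrite -eval_covec_mulmx nuK// eval_covec0r.
Qed.

Lemma lift_genK q : proj_gen (lift_gen q) = q.
Proof.
have [GK _] := KP; case: q => Z a; rewrite /proj_gen /lift_gen /=.
by rewrite -!mulmxA -trmx_mul GK trmx1 !mulmx1.
Qed.

Lemma gpair_lift q p : gpair (lift_gen q) p = gpair q (proj_gen p).
Proof. by rewrite /gpair /= !eval_covec_mulmx. Qed.

Hypothesis split_L : is_dsum (L (iota x)) (L_nu L iota nu x) (L_tan L iota nu x).

(** This is where proper normalization enters: the component of p in L_tan is
    lift_gen (proj_gen p), hence belongs to L. *)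
Lemma lift_proj_mem p : L (iota x) p -> L (iota x) (lift_gen (proj_gen p)).
Proof.
have [GK nuK] := KP; have [E _] := split_L.
move=> Lp; have := Lp; rewrite {1}E => -[p1 [_ [n1 a1]] [p2 [Lp2 [[u _ tu] a2]] <-]].
suff -> : lift_gen (proj_gen (p1 + p2)) = p2 by [].
move: n1 a1 tu a2 {Lp Lp2}; case: p1 => Z1 b1; case: p2 => Z2 b2 /=.
move=> n1 /ann_tanNP b10 tu /ann_nuP b2E.
rewrite /lift_gen /proj_gen /= !mulmxDl nuK// b10 !mul0mx !add0r -b2E.
by rewrite -tu tmapE -/G -[u *m G *m K]mulmxA GK mulmx1.
Qed.

(** A covector restricting to q.2 may be changed by an element of the conormal
    space; proper normalization allows to choose the one that kills nu x. *)
Lemma pullbackP q : pullback L iota x q <-> L (iota x) (lift_gen q).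
Proof.
have [GK nuK] := KP; split=> [[Z [a [La ->]]]|Lq].
  rewrite tmapE -/G in La; have := lift_proj_mem La.
  by rewrite /proj_gen /= -mulmxA GK mulmx1 cotmapE.
exists q.1, (q.2 *m K^T); rewrite tmapE cotmapE; split=> //.
by rewrite -/G -mulmxA -trmx_mul GK trmx1 mulmx1; case: q Lq.
Qed.

Lemma pullback_proj p : L (iota x) p -> pullback L iota x (proj_gen p).
Proof. by move=> Lp; apply/pullbackP; exact: lift_proj_mem. Qed.

Lemma projectedP q : projected L iota nu x q <-> pullback L iota x q.
Proof.
have [GK nuK] := KP.
split=> [[Z [a [w [b [La [tw nw] [/ann_nuP bE ab] wE qE]]]]]|/pullbackP Lq].
  have -> : q = proj_gen (Z, a).
    case: q wE qE => q1 q2 /= wE qE; rewrite /proj_gen /=; congr pair.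
      have := nuK _ nw; rewrite mulmxBl wE tmapE -/G -mulmxA GK mulmx1.
      by move/eqP; rewrite subr_eq0 => /eqP.
    have /ann_tanNP := ab; rewrite mulmxBl qE cotmapE.
    by move/eqP; rewrite subr_eq0 => /eqP.
  exact: pullback_proj.
exists (q.1 *m G), (q.2 *m K^T), (q.1 *m G), (q.2 *m K^T); split=> //.
- split; first by exists q.1; rewrite ?tmapE.
  by rewrite subrr; exact: nu0.
- split.
    by apply/ann_nuP; rewrite -[q.2 *m K^T *m G^T]mulmxA -trmx_mul GK trmx1 mulmx1.
  by rewrite subrr; apply/ann_tanNP; rewrite mul0mx.
- by rewrite tmapE.
- by rewrite cotmapE -mulmxA -trmx_mul GK trmx1 mulmx1.
Qed.

Hypothesis iso_L : isotropic (L (iota x)).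
Hypothesis perp_L :
  forall w, (forall p, L (iota x) p -> gpair w p = 0) -> L (iota x) w.

Lemma pullback_isotropic : isotropic (pullback L iota x).
Proof.
move=> q q' /pullbackP Lq /pullbackP Lq'.
by rewrite -[q']lift_genK -gpair_lift; exact: iso_L.
Qed.

(** lift_gen and proj_gen are adjoint for the pairings, so the fact that L is its
    own orthogonal passes to the pullback. *)
Lemma pullback_perp w :
  (forall q, pullback L iota x q -> gpair w q = 0) -> pullback L iota x w.
Proof.
move=> h; apply/pullbackP/perp_L => p Lp; rewrite gpair_lift.
exact/h/pullback_proj.
Qed.

End Pointwise.

(** * Smoothness of the projection along the normal bundle *)

Section LocalProjection.
Context {R : realType} {m n : nat} {M : manifold R m} {N : manifold R n}.
Variables (iota : N -> M) (nu : N -> set 'rV[R]_m).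
Hypotheses (hiota : embedding iota) (hnu : normal_bundle iota nu).

Let sm : smooth_map iota. Proof. by case: hiota. Qed.

(** The components in d of a frame of nu and of the coordinate frame of N form
    an invertible smooth matrix, so smooth_projection applies. *)
Lemma smooth_local_projection x0 c d : atlas (m := N) c -> atlas (m := M) d ->
  chart_dom c x0 -> chart_dom d (iota x0) ->
  exists (U : set N) (K : 'rV[R]_n -> 'M[R]_(m, n)),
    [/\ open U, U x0, U `<=` chart_dom c `&` iota @^-1` chart_dom d,
        smooth_on (chart_fwd c @` U) K &
        forall z, U z -> tangent_mx iota c d z *m K (chart_fwd c z) = 1%:M /\
          forall v, nu z v -> vec_in d (iota z) v *m K (chart_fwd c z) = 0].
Proof.
move=> ac ad cx dx; have [[k fr] dir] := hnu.
have [W [s [oW Wx ss sfr]]] := fr x0.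
pose U := W `&` chart_dom c `&` iota @^-1` chart_dom d.
have oU : open U.
  by rewrite /U -setIA; apply: openI => //; exact: chart_preimage_open.
have Uc : U `<=` chart_dom c by move=> z [[]].
have Ud z : U z -> chart_dom d (iota z) by case.
have oA := chart_img_open_sub oU Uc.
pose E y := coord_mx (vec_in d (iota (chart_bwd c y)))
  (fun i => s i (chart_bwd c y)).
have sE : smooth_on (chart_fwd c @` U) E.
  apply/(smooth_mxP _ oA) => i j.
  have /(smooth_mxP _ oA)/(_ 0 j) := ss i c d ac ad.
  by apply: smooth_on_ext => // y _; rewrite /E !mxE.
pose G := jacobian (chart_fwd d \o iota \o chart_bwd c).
have sG : smooth_on (chart_fwd c @` U) G.
  by apply: smooth_jacobian => //; exact: smooth_loc.
have [|K sK KP] := smooth_projection oA sE sG.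
  move=> _ [z Uz <-]; have cz := Uc _ Uz; have dz := Ud _ Uz.
  have [Wz _] : W z /\ True by case: Uz => -[].
  have [fz nuz] := sfr z Wz; have [nT n0] := dir z.
  have lin := @vec_in_linear _ _ M d (iota z).
  have inj := vec_in_inj ad dz.
  rewrite /E chart_fwdK//; set Ez := coord_mx _ _.
  have Gz : G (chart_fwd c z) = tangent_mx iota c d z by [].
  have tz w : vec_in d (iota z) (tmap iota z w) = vec_in c z w *m G (chart_fwd c z).
    by rewrite (vec_in_tmap sm w ac ad cz dz).
  have trc : tangent_mx id c (chart_at z) z *m tangent_mx id (chart_at z) c z = 1%:M.
    by apply: transitionK => //; [exact: chart_at_atlas|exact: chart_at_dom].
  have trd : tangent_mx id d (chart_at (iota z)) (iota z) *m
      tangent_mx id (chart_at (iota z)) d (iota z) = 1%:M.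
    by apply: transitionK => //; [exact: chart_at_atlas|exact: chart_at_dom].
  split.
    apply/inj_row_free => u; rewrite -[u]hsubmxK mul_row_col.
    set u1 := lsubmx u; set u2 := rsubmx u => u0.
    pose w := u2 *m tangent_mx id c (chart_at z) z.
    have wE : vec_in c z w = u2 by rewrite vec_inE -mulmxA trc mulmx1.
    pose v := - tmap iota z w.
    have vE : vec_in d (iota z) v = u1 *m Ez.
      have -> : v = (-1) *: tmap iota z w + 0 by rewrite scaleN1r addr0.
      rewrite lin tz wE vec_inE mul0mx addr0 scaleN1r.
      by apply/eqP; rewrite eq_sym -addr_eq0 u0.
    have nv : nu z v.
      rewrite nuz /=; rewrite (span_coord_mx lin inj) vE.
      exact: submxMl.
    have tv : Defs.tanN iota z v.
      by exists (- w) => //; rewrite /v !tmapE mulNmx.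
    have v0 : v = 0.
      have : [set (0 : 'rV[R]_m)] v by rewrite -n0.
      by [].
    have w0 : w = 0.
      have [_ injt _ _] := hiota; apply: (injt z).
      by apply: oppr_inj; rewrite -/v v0 tmapE mul0mx oppr0.
    have -> : u2 = 0 by rewrite -wE w0 vec_inE mul0mx.
    suff -> : u1 = 0 by rewrite row_mx0.
    apply/eqP; rewrite -(mulmx_free_eq0 _ (_ : row_free Ez)).
      by rewrite -vE v0 vec_inE mul0mx.
    by rewrite -(free_coord_mx lin inj).
  rewrite -sub1mx; apply/row_subP => i.
  pose v := row i 1%:M *m tangent_mx id d (chart_at (iota z)) (iota z).
  have <- : vec_in d (iota z) v = row i 1%:M by rewrite vec_inE -mulmxA trd mulmx1.
  have : [set: 'rV[R]_m] v by [].
  rewrite nT => -[a na [_ [w _ <-] <-]].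
  rewrite -addsmxE.
  have -> : a + tmap iota z w = 1 *: a + tmap iota z w by rewrite scale1r.
  rewrite lin scale1r tz; apply: addmx_sub_adds; last exact: submxMl.
  by rewrite -(span_coord_mx lin inj); move: na; rewrite nuz.
exists U, K; split=> //.
  by move=> z [[Wz cz] dz].
move=> z Uz; have [|EK GK] := KP (chart_fwd c z); first by exists z.
have cz := Uc _ Uz; have dz := Ud _ Uz.
split=> // v; have Wz : W z by case: Uz => -[].
have [_ ->] := sfr z Wz;
rewrite /= (span_coord_mx (@vec_in_linear _ _ M d (iota z)) (vec_in_inj ad dz)).
by move/submxP => [e ->]; rewrite -mulmxA; move: EK; rewrite /E chart_fwdK// => ->; rewrite mulmx0.
Qed.

Lemma exists_tangent_projection x : exists K, tangent_projection iota nu x K.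
Proof.
have [U [K [_ Ux _ _ KP]]] := smooth_local_projection
  (chart_at_atlas x) (chart_at_atlas (iota x)) (chart_at_dom x) (chart_at_dom (iota x)).
have [GK nuK] := KP x Ux; exists (K (chart_fwd (chart_at x) x)); split=> // v /nuK.
by rewrite vec_in_chart_at.
Qed.

(** K and Kc are the same projection read in different charts: both sides kill
    nu z and agree on the range of tmap, and these two subspaces span. *)
Lemma tangent_projection_transition c d z (K Kc : 'M[R]_(m, n)) :
  atlas (m := N) c -> atlas (m := M) d ->
  chart_dom c z -> chart_dom d (iota z) ->
  tangent_projection iota nu z K ->
  tangent_mx iota c d z *m Kc = 1%:M ->
  (forall v, nu z v -> vec_in d (iota z) v *m Kc = 0) ->
  K *m tangent_mx id (chart_at z) c z =
  tangent_mx id (chart_at (iota z)) d (iota z) *m Kc.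
Proof.
move=> ac ad cz dz [GK nuK] GKc nuKc; have [_ /(_ z)[nT _]] := hnu.
apply/row_matrixP => i; rewrite !rowE !mulmxA -[delta_mx 0 i *m K *m _]vec_inE.
rewrite -vec_inE.
have : [set: 'rV[R]_m] (delta_mx 0 i) by [].
rewrite nT => -[a na [_ [w _ <-] <-]].
rewrite mulmxDl nuK// add0r tmapE -mulmxA GK mulmx1.
have -> : a + w *m tmap_mx iota z = 1 *: a + tmap iota z w by rewrite scale1r tmapE.
rewrite vec_in_linear scale1r mulmxDl nuKc// add0r (vec_in_tmap sm w ac ad cz dz).
by rewrite -mulmxA GKc mulmx1.
Qed.

End LocalProjection.

(** * The pullback is a smooth bundle of maximal isotropic subspaces *)

Section SmoothGen.
Context {R : realType} {m : nat} {M : manifold R m}.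

Lemma smooth_gen_in (V : set M) (s : M -> fibre R m) d : open V ->
  atlas (m := M) d -> smooth_gen V s ->
  smooth_on (chart_fwd d @` (V `&` chart_dom d))
    (fun y => gen_in d (chart_bwd d y) (s (chart_bwd d y))).
Proof.
move=> oV ad [sv sc]; apply: smooth_row_mx; [|exact: sv|exact: sc].
exact: chart_img_nbhs_open.
Qed.

Lemma smooth_gen_frame (V : set M) r (s : 'I_r -> M -> fibre R m) d : open V ->
  atlas (m := M) d -> (forall i, smooth_gen V (s i)) ->
  smooth_on (chart_fwd d @` (V `&` chart_dom d))
    (fun y => coord_mx (gen_in d (chart_bwd d y)) (fun i => s i (chart_bwd d y))).
Proof.
move=> oV ad ss; have oB := @chart_img_nbhs_open _ _ _ d _ oV.
apply/(smooth_mxP _ oB) => i j.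
have /(smooth_mxP _ oB)/(_ 0 j) := smooth_gen_in oV ad (ss i).
by apply: smooth_on_ext => // y _; rewrite [RHS]mxE.
Qed.

Lemma smooth_gen_chart (U : set M) c (s : M -> fibre R m) : open U ->
  U `<=` chart_dom c -> atlas (m := M) c ->
  smooth_on (chart_fwd c @` U)
    (fun y => gen_in c (chart_bwd c y) (s (chart_bwd c y))) ->
  smooth_gen U s.
Proof.
move=> oU Uc ac; have oA := chart_img_open_sub oU Uc.
move=> /(smooth_mxP _ oA) ss; split.
  apply: (smooth_vec_chart oU Uc ac); apply/(smooth_mxP _ oA) => a b.
  apply: (smooth_on_ext oA _ (ss a (lshift m b))) => y _.
  by rewrite /gen_in row_mxEl.
apply: (smooth_covec_chart oU Uc ac); apply/(smooth_mxP _ oA) => a b.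
apply: (smooth_on_ext oA _ (ss a (rshift m b))) => y _.
by rewrite /gen_in row_mxEr.
Qed.

Lemma smooth_gen_sub (U V : set M) (s : M -> fibre R m) : U `<=` V ->
  smooth_gen V s -> smooth_gen U s.
Proof.
move=> UV [sv sc]; split=> d ad; [move: (sv d ad)|move: (sc d ad)];
  by apply: smooth_on_sub => _ [x [/UV Vx dx] <-]; exists x.
Qed.

Definition gen_mx d (x : M) : 'M[R]_(m + m) :=
  block_mx (tangent_mx id (chart_at x) d x) 0 0 (tangent_mx id d (chart_at x) x)^T.

Lemma gen_inE d (x : M) p : gen_in d x p = flat p *m gen_mx d x.
Proof.
by rewrite /gen_in vec_inE covec_inE /flat mul_row_block !mulmx0 addr0 add0r.
Qed.

Lemma gen_mx_free d (x : M) : atlas (m := M) d -> chart_dom d x ->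
  row_free (gen_mx d x).
Proof.
move=> ad dx; apply/row_freeP.
exists (block_mx (tangent_mx id d (chart_at x) x) 0 0
  (tangent_mx id (chart_at x) d x)^T).
rewrite mulmx_block !mul0mx !mulmx0 !addr0 !add0r -trmx_mul.
have ax := chart_at_atlas x; have cx := chart_at_dom x.
by rewrite !transitionK// trmx1 -scalar_mx_block.
Qed.

Lemma dirac_perp (L : M -> set (fibre R m)) x w : dirac_structure L ->
  (forall p, L x p -> gpair w p = 0) -> L x w.
Proof.
move=> [sub mi _]; have [V [s [_ Vx _ fr]]] := sub x.
have [fs Ls] := fr x Vx; have [iso _] := mi x.
have memL q : L x q <-> (flat q <= coord_mx (@flat R m) (fun i => s i x))%MS.
  by rewrite Ls /= (span_coord_mx (@flat_linear R m) (@flat_inj R m)).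
move=> h; apply/memL/isotropic_full_rank.
- by rewrite -(free_coord_mx (@flat_linear R m) (@flat_inj R m)).
- by move=> p q /memL Lp /memL Lq; exact: iso.
- by move=> q /memL; exact: h.
Qed.

End SmoothGen.

Section Induced.
Context {R : realType} {m n : nat} {M : manifold R m} {N : manifold R n}.
Variables (L : M -> set (fibre R m)) (iota : N -> M) (nu : N -> set 'rV[R]_m).
Hypotheses (hL : dirac_structure L) (hiota : embedding iota)
  (hN : properly_normalized L iota nu).

Let sm : smooth_map iota. Proof. by case: hiota. Qed.
Let hnu : normal_bundle iota nu. Proof. by case: hN. Qed.

Definition tangent_proj x : 'M[R]_(m, n) :=
  projT1 (cid (exists_tangent_projection hiota hnu x)).

Lemma tangent_projP x : tangent_projection iota nu x (tangent_proj x).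
Proof. by rewrite /tangent_proj; case: cid. Qed.

Let split_TM x : is_dsum setT (nu x) (Defs.tanN iota x).
Proof. by case: hnu. Qed.

Let split_L x : is_dsum (L (iota x)) (L_nu L iota nu x) (L_tan L iota nu x).
Proof. by case: hN. Qed.

Lemma pullback_eq_projected : pullback L iota = projected L iota nu.
Proof.
apply/funext => x; apply/seteqP; split=> q.
  by move/(projectedP (tangent_projP x) (split_TM x) (split_L x)).
by move/(projectedP (tangent_projP x) (split_TM x) (split_L x)).
Qed.

Lemma pullback_max_isotropic x : max_isotropic (pullback L iota x).
Proof.
have [_ /(_ (iota x))[iso _] _] := hL.
apply: max_isotropic_perp.
  exact: (pullback_isotropic (tangent_projP x) (split_TM x) (split_L x)).
apply: (pullback_perp (tangent_projP x) (split_TM x) (split_L x)) => w.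
exact: dirac_perp.
Qed.

(** A frame s of L and the chart expression K of the projection onto TN, given
    on a common neighbourhood: the data shared by the smoothness of the pullback
    and by its integrability. *)
Lemma local_frame_projection x0 c d : atlas (m := N) c -> atlas (m := M) d ->
  chart_dom c x0 -> chart_dom d (iota x0) ->
  exists (V : set M) (s : 'I_m -> M -> fibre R m) (U : set N)
      (K : 'rV[R]_n -> 'M[R]_(m, n)),
    [/\ open V /\ V (iota x0),
        forall i, smooth_gen V (s i),
        forall y, V y -> free [seq s i y | i <- enum 'I_m] /\
          L y = [set` <<[seq s i y | i <- enum 'I_m]>>%VS],
        [/\ open U, U x0 & U `<=` chart_dom c `&` iota @^-1` (V `&` chart_dom d)] &
        smooth_on (chart_fwd c @` U) K /\
        forall z, U z -> tangent_mx iota c d z *m K (chart_fwd c z) = 1%:M /\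
          tangent_proj z *m tangent_mx id (chart_at z) c z =
          tangent_mx id (chart_at (iota z)) d (iota z) *m K (chart_fwd c z)].
Proof.
move=> ac ad cx dx; have [sub _ _] := hL.
have [V [s [oV Vx ss fr]]] := sub (iota x0).
have [U [K [oU Ux Ucd sK KP]]] := smooth_local_projection hiota hnu ac ad cx dx.
have oUV : open (U `&` iota @^-1` V).
  by apply: openI => //; have [/continuousP fc _] := sm; exact: fc.
exists V, s, (U `&` iota @^-1` V), K; split=> //.
  by split=> // z [/Ucd[cz dz] Vz].
split; first by apply: smooth_on_sub sK => _ [z [Uz _] <-]; exists z.
move=> z [Uz Vz]; have [cz dz] := Ucd z Uz; have [GK nuK] := KP z Uz.
split=> //.
exact: (tangent_projection_transition hiota hnu ac ad cz dz (tangent_projP z) GK nuK).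
Qed.

Lemma gen_in_proj c d z p Kc : atlas (m := N) c -> atlas (m := M) d ->
  chart_dom c z -> chart_dom d (iota z) ->
  tangent_proj z *m tangent_mx id (chart_at z) c z =
    tangent_mx id (chart_at (iota z)) d (iota z) *m Kc ->
  gen_in c z (proj_gen iota z (tangent_proj z) p) =
  gen_in d (iota z) p *m block_mx Kc 0 0 (tangent_mx iota c d z)^T.
Proof.
move=> ac ad cz dz E; rewrite /gen_in /proj_gen mul_row_block !mulmx0 addr0 add0r.
congr row_mx; first by rewrite !vec_inE -!mulmxA E.
rewrite -[p.2 *m _](cotmapE iota z).
by rewrite (covec_in_cotmap sm _ ac ad cz dz).
Qed.

(** The projections of a local frame of L span the pullback, and they are smooth
    since the projection is. The pullback is its own orthogonal, so its dimension
    is n everywhere; hence n of the projected sections that are independent at x0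
    remain independent nearby and form a frame there. *)
Lemma pullback_subbundle : subbundle smooth_gen n (pullback L iota).
Proof.
move=> x0; pose c := chart_at x0; pose d := chart_at (iota x0).
have ac : atlas (m := N) c := chart_at_atlas x0.
have ad : atlas (m := M) d := chart_at_atlas (iota x0).
have [V [s [U [K [[oV Vx] ss fr [oU Ux Usub] [sK KP]]]]]] :=
  local_frame_projection ac ad (chart_at_dom x0) (chart_at_dom (iota x0)).
have Uc : U `<=` chart_dom c by move=> z /Usub[].
have Ud z : U z -> chart_dom d (iota z) by move=> /Usub[_ []].
have UV z : U z -> V (iota z) by move=> /Usub[_ []].
have oA := chart_img_open_sub oU Uc.
have oB := @chart_img_nbhs_open _ _ _ d _ oV.
pose g := chart_fwd d \o iota \o chart_bwd c.
have sg : smooth_on (chart_fwd c @` U) g by exact: smooth_loc.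
have AB y : (chart_fwd c @` U) y -> (chart_fwd d @` (V `&` chart_dom d)) (g y).
  move=> [z Uz <-]; exists (iota z); first by split; [exact: UV|exact: Ud].
  by rewrite /g /= chart_fwdK//; exact: Uc.
pose Fr y := coord_mx (gen_in d (chart_bwd d y)) (fun i => s i (chart_bwd d y)).
pose B y := block_mx (K y) 0 0 (jacobian g y)^T.
have sB : smooth_on (chart_fwd c @` U) B.
  have s1 := smooth_row_mx oA sK (@smooth_cst _ _ _ (chart_fwd c @` U) (0 : 'M[R]_(m, n))).
  have s2 := smooth_row_mx oA (@smooth_cst _ _ _ (chart_fwd c @` U) (0 : 'M[R]_(m, n)))
    (smooth_trmx oA (smooth_jacobian oA sg)).
  have s3 := smooth_row_mx oA (smooth_trmx oA s1) (smooth_trmx oA s2).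
  apply: smooth_on_ext (smooth_trmx oA s3) => // y _.
  by rewrite tr_row_mx !trmxK.
(* the rows of W are the projected sections in the chart c *)
pose W y := Fr (g y) *m B y.
have sW : smooth_on (chart_fwd c @` U) W.
  apply: smooth_mulmx => //.
  exact: (smooth_comp oA oB AB sg (smooth_gen_frame oV ad ss)).
pose r i z := proj_gen iota z (tangent_proj z) (s i (iota z)).
have rW z : U z -> coord_mx (gen_in c z) (fun i => r i z) = W (chart_fwd c z).
  move=> Uz; apply/row_matrixP => i; rewrite rowK /W row_mul /r.
  have [_ E] := KP z Uz.
  rewrite (gen_in_proj _ ac ad (Uc _ Uz) (Ud _ Uz) E) /B.
  congr mulmx; rewrite rowK /g /=.
  by rewrite (chart_fwdK (Uc _ Uz)) (chart_fwdK (Ud _ Uz)).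
have glin z := @gen_in_linear _ _ N c z.
have ginj z : U z -> injective (gen_in c z) by move=> /Uc cz; exact: gen_in_inj.
have memP z q : U z -> pullback L iota z q <-> (gen_in c z q <= W (chart_fwd c z))%MS.
  move=> Uz; have [_ Ls] := fr _ (UV _ Uz).
  have dl := @gen_in_linear _ _ M d (iota z).
  have di : injective (gen_in d (iota z)) by apply: gen_in_inj => //; exact: Ud.
  have memL p : L (iota z) p <->
      (gen_in d (iota z) p <= coord_mx (gen_in d (iota z)) (fun i => s i (iota z)))%MS.
    by rewrite Ls /= (span_coord_mx dl di).
  have FE : Fr (g (chart_fwd c z)) = coord_mx (gen_in d (iota z)) (fun i => s i (iota z)).
    by rewrite /Fr /g /= (chart_fwdK (Uc _ Uz)) (chart_fwdK (Ud _ Uz)).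
  have [_ E] := KP z Uz.
  split=> [/(pullbackP (tangent_projP z) (split_TM z) (split_L z)) /memL Lq|].
    rewrite -{1}(lift_genK (tangent_projP z) q) (gen_in_proj _ ac ad (Uc _ Uz) (Ud _ Uz) E).
    by rewrite /W FE /B; exact: submxMr.
  move/submxP => [e eE].
  pose p := \sum_i e 0 i *: s i (iota z).
  have pE : gen_in d (iota z) p = e *m Fr (g (chart_fwd c z)).
    by rewrite FE; exact: coord_mx_comb.
  have -> : q = proj_gen iota z (tangent_proj z) p.
    apply: (ginj _ Uz); rewrite (gen_in_proj _ ac ad (Uc _ Uz) (Ud _ Uz) E) pE.
    by rewrite eE /W mulmxA.
  apply: (pullback_proj (tangent_projP z) (split_TM z) (split_L z)).
  by apply/memL; rewrite pE FE submxMl.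
have rkW z : U z -> \rank (W (chart_fwd c z)) = n.
  move=> Uz; have cz := Uc _ Uz.
  pose W0 := coord_mx (@flat R n) (fun i => r i z).
  have WE : W (chart_fwd c z) = W0 *m gen_mx c z.
    rewrite -rW//; apply/row_matrixP => i; rewrite row_mul !rowK.
    exact: gen_inE.
  have fg := gen_mx_free ac cz.
  rewrite WE mxrankMfree//.
  have mem0 q : pullback L iota z q <-> (flat q <= W0)%MS.
    rewrite (memP z q Uz) gen_inE WE; split=> [/submxP[e]|/submxMr]; last exact.
    by rewrite mulmxA => /(row_free_inj fg) ->; exact: submxMl.
  have iP := pullback_isotropic (tangent_projP z) (split_TM z) (split_L z)
    ((let: And3 _ h _ := hL in h) (iota z)).1.
  apply: rank_self_perp => w; split=> [/mem0 Pw q /mem0 Pq|h].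
    exact: iP.
  apply/mem0/(pullback_perp (tangent_projP z) (split_TM z) (split_L z)) => [v|q /mem0].
    exact: dirac_perp.
  exact: h.
(* f selects n projected sections that are independent at x0 *)
have [f ff] : exists f : 'I_n -> 'I_m, row_free (rowsub f (W (chart_fwd c x0))).
  have := maxrowsub_free (W (chart_fwd c x0)); move: (maxrankfun _).
  by rewrite (rkW _ Ux) => h hf; exists h.
(* a fixed right inverse Q at x0 turns independence nearby into invertibility *)
have [Q fQ] := row_freeP ff.
have sWQ : smooth_on (chart_fwd c @` U) (fun y => rowsub f (W y) *m Q).
  apply: smooth_mulmx => //; last exact: smooth_cst.
  apply/(smooth_mxP _ oA) => i j; have /(smooth_mxP _ oA)/(_ (f i) j) := sW.
  by apply: smooth_on_ext => // y _; rewrite [RHS]mxE.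
have Ax0 : (chart_fwd c @` U) (chart_fwd c x0) by exists x0.
have [|A1 [oA1 A1x _ WQu]] := unitmx_near oA Ax0 sWQ; first by rewrite fQ unitmx1.
pose U1 := U `&` (chart_dom c `&` chart_fwd c @^-1` A1).
have oU1 : open U1 by apply: openI => //; exact: chart_preimage_fwd_open.
have U1U : U1 `<=` U by move=> z [].
exists U1, (fun i z => r (f i) z); split=> // [|i|z U1z].
- by split=> //; split=> //; exact: chart_at_dom.
- have rs : smooth_on (chart_fwd c @` U1)
      (fun y => gen_in c (chart_bwd c y) (r (f i) (chart_bwd c y))).
    have oU1' := chart_img_open_sub oU1 (subset_trans U1U Uc).
    have : smooth_on (chart_fwd c @` U1) W.
      by apply: smooth_on_sub sW => _ [z /U1U Uz <-]; exists z.
    move=> /(smooth_mxP _ oU1') Ws; apply/(smooth_mxP _ oU1') => a b.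
    apply: (smooth_on_ext oU1' _ (Ws (f i) b)) => _ [z /U1U Uz <-].
    by rewrite -rW// mxE (chart_fwdK (Uc _ Uz)) ord1.
  exact: smooth_gen_chart oU1 (subset_trans U1U Uc) ac rs.
have Uz := U1U z U1z; have WQz := WQu _ U1z.2.2.
have CE : coord_mx (gen_in c z) (fun i => r (f i) z) = rowsub f (W (chart_fwd c z)).
  by rewrite -rW//; apply/matrixP => i j; rewrite !mxE.
have free_z : row_free (rowsub f (W (chart_fwd c z))).
  apply/row_freeP; exists (Q *m invmx (rowsub f (W (chart_fwd c z)) *m Q)).
  by rewrite mulmxA mulmxV.
rewrite (free_coord_mx (glin z) (ginj _ Uz)) CE; split=> //.
have sub : (rowsub f (W (chart_fwd c z)) <= W (chart_fwd c z))%MS.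
  by apply/row_subP => i; rewrite row_rowsub row_sub.
have eqW : (W (chart_fwd c z) <= rowsub f (W (chart_fwd c z)))%MS.
  by rewrite -(geq_leqif (mxrank_leqif_sup sub)) (rkW _ Uz) (eqP free_z).
apply/seteqP; split=> q /=.
  move/(memP z q Uz) => h; rewrite (span_coord_mx (glin z) (ginj _ Uz)) CE.
  exact: submx_trans h eqW.
rewrite (span_coord_mx (glin z) (ginj _ Uz)) CE => h; apply/(memP z q Uz).
exact: submx_trans h sub.
Qed.

End Induced.

(** * Integrability of the pullback *)

Section AffineJet.
Context {R : realType} {n m : nat}.

Lemma affine_differentiable (a : 'rV[R]_m) (q q0 : 'rV[R]_n) (C : 'M[R]_(n, m)) :
  differentiable (fun w => a + (w - q) *m C) q0 /\
  forall v, 'D_v (fun w => a + (w - q) *m C) q0 = v *m C.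
Proof.
have E : (fun w => a + (w - q) *m C) = cst (a - q *m C) + (fun w => w *m C).
  by apply/funext => w; rewrite mulmxBl -[RHS]/(a - q *m C + w *m C) addrAC addrA.
have dC : differentiable (fun _ : 'rV[R]_n => C) q0 by exact: differentiable_cst.
have did : differentiable (fun w : 'rV[R]_n => w) q0 by exact: ex_diff.
have dw : differentiable (fun w : 'rV[R]_n => w *m C) q0.
  exact: (differentiable_mulmx did dC).
have dc : differentiable (cst (a - q *m C) : 'rV[R]_n -> 'rV[R]_m) q0.
  exact: differentiable_cst.
rewrite E; split; first exact: differentiableD.
move=> v; apply: (etrans (deriveD (@diff_derivable _ _ _ _ _ v dc)
  (@diff_derivable _ _ _ _ _ v dw))).
rewrite derive_cst add0r; apply: (etrans (derive_mulmx v did dC)).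
have -> : 'D_v (fun _ : 'rV[R]_n => C) q0 = 0 by exact: derive_cst.
have -> : 'D_v (fun w : 'rV[R]_n => w) q0 = v by exact: derive_id.
by rewrite mulmx0 addr0.
Qed.

Lemma affine_smooth (a : 'rV[R]_m) (q : 'rV[R]_n) (C : 'M[R]_(n, m)) A : open A ->
  smooth_on A (fun w => a + (w - q) *m C).
Proof.
move=> oA; apply: smooth_onD => //; first exact: smooth_cst.
apply: smooth_mulmx => //; last exact: smooth_cst.
by apply: smooth_onD => //; [exact: smooth_id|exact: smooth_cst].
Qed.

End AffineJet.

Section CourantClosed.
Context {R : realType} {m n : nat} {M : manifold R m} {N : manifold R n}.
Variables (L : M -> set (fibre R m)) (iota : N -> M) (nu : N -> set 'rV[R]_m).
Hypotheses (hL : dirac_structure L) (hiota : embedding iota)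
  (hN : properly_normalized L iota nu).

Let sm : smooth_map iota. Proof. by case: hiota. Qed.
Let hnu : normal_bundle iota nu. Proof. by case: hN. Qed.

Section AtPoint.
Variable x : N.
Let c := chart_at x.
Let d := chart_at (iota x).
Let ac : atlas (m := N) c. Proof. exact: chart_at_atlas. Qed.
Let ad : atlas (m := M) d. Proof. exact: chart_at_atlas. Qed.
Let cx : chart_dom c x. Proof. exact: chart_at_dom. Qed.
Let dx : chart_dom d (iota x). Proof. exact: chart_at_dom. Qed.
Let p := chart_fwd c x.
Let g := chart_fwd d \o iota \o chart_bwd c.
Local Notation G := (jacobian g).

(** The lift of s to L along N is a combination of a local frame of L with smooth
    coefficients f. No extension of f to M is needed: the affine function ph on
    the chart d, built from f p, the derivative of f at p and the left inverse K p
    of the tangent map, satisfies ph \o g = f to first order at p. Combining the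
    frame with the coefficients ph gives a section S of L on an open set of M that
    restricts to s to first order at x. *)
Lemma extend_section (U : set N) (s : N -> fibre R n) :
  open U -> U x -> smooth_gen U s -> (forall z, U z -> pullback L iota z (s z)) ->
  exists (V : set M) (S : M -> fibre R m),
    [/\ open V, V (iota x), smooth_gen V S, forall y, V y -> L y (S y) &
      same_jet p (loc_vec (iota x) (fun z => (S z).1) \o g)
        (fun y => loc_vec x (fun z => (s z).1) y *m G y) /\
      same_jet p (loc_covec x (fun z => (s z).2))
        (fun y => loc_covec (iota x) (fun z => (S z).2) (g y) *m (G y)^T)].
Proof.
move=> oU Ux ss sL.
have [V [fr [U0 [K [[oV Vx] frs frL [oU0 U0x U0sub] [sK KP]]]]]] :=
  local_frame_projection hL hiota hN ac ad cx dx.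
pose W := U `&` U0.
have oW : open W by exact: openI.
have Wx : W x by [].
have Wc : W `<=` chart_dom c by move=> z [_ /U0sub[]].
have Wd z : W z -> chart_dom d (iota z) by move=> [_ /U0sub[_ []]].
have WV z : W z -> V (iota z) by move=> [_ /U0sub[_ []]].
have oA := chart_img_open_sub oW Wc.
have Ap : (chart_fwd c @` W) p by exists x.
have sg : smooth_on (chart_fwd c @` W) g by exact: smooth_loc.
have sG := smooth_jacobian oA sg.
have {}sK : smooth_on (chart_fwd c @` W) K.
  by apply: smooth_on_sub sK => _ [z [_ Uz] <-]; exists z.
have oB := @chart_img_nbhs_open _ _ _ d _ oV.
have AB y : (chart_fwd c @` W) y -> (chart_fwd d @` (V `&` chart_dom d)) (g y).
  move=> [z Wz <-]; exists (iota z); first by split; [exact: WV|exact: Wd].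
  by rewrite /g /= chart_fwdK//; exact: Wc.
pose Fr y := coord_mx (gen_in d (chart_bwd d y)) (fun i => fr i (chart_bwd d y)).
have sFr : smooth_on (chart_fwd d @` (V `&` chart_dom d)) Fr.
  exact: smooth_gen_frame.
have sFrg : smooth_on (chart_fwd c @` W) (Fr \o g).
  exact: smooth_comp oA oB AB sg sFr.
have dlin y := @gen_in_linear _ _ M d y.
have dinj y : chart_dom d y -> injective (gen_in d y) by move=> ?; exact: gen_in_inj.
have FrE y : chart_dom d y ->
    Fr (chart_fwd d y) = coord_mx (gen_in d y) (fun i => fr i y).
  by move=> dy; rewrite /Fr chart_fwdK.
have gE z : W z -> g (chart_fwd c z) = chart_fwd d (iota z).
  by move=> Wz; rewrite /g /= chart_fwdK//; exact: Wc.
pose sv := loc_vec x (fun z => (s z).1).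
pose sc := loc_covec x (fun z => (s z).2).
have ssv : smooth_on (chart_fwd c @` W) sv.
  by apply: smooth_on_sub (ss.1 c ac) => _ [z [Uz U0z] <-]; exists z => //; split=> //; apply: Wc.
have ssc : smooth_on (chart_fwd c @` W) sc.
  by apply: smooth_on_sub (ss.2 c ac) => _ [z [Uz U0z] <-]; exists z => //; split=> //; apply: Wc.
pose l y := row_mx (sv y *m G y) (sc y *m (K y)^T).
have sl : smooth_on (chart_fwd c @` W) l.
  by apply: smooth_row_mx => //; apply: smooth_mulmx => //; exact: smooth_trmx.
have lFr y : (chart_fwd c @` W) y -> (l y <= Fr (g y))%MS.
  move=> [z Wz <-]; have cz := Wc _ Wz; have dz := Wd _ Wz.
  have [Uz U0z] := Wz; have [GK KE] := KP z U0z.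
  have -> : l (chart_fwd c z) = gen_in d (iota z) (lift_gen iota z (tangent_proj hiota hN z) (s z)).
    rewrite /l /gen_in /lift_gen /=; congr row_mx.
      have <- := tmapE iota z (s z).1.
      apply: (etrans _ (esym (vec_in_tmap sm _ ac ad cz dz))).
      by rewrite /sv /loc_vec -/c chart_fwdK.
    rewrite /sc /loc_covec -/c chart_fwdK// !covec_inE -!mulmxA -!trmx_mul.
    congr (_ *m _^T).
    have az := chart_at_atlas z; have aiz := chart_at_atlas (iota z).
    have dzz := chart_at_dom z; have diz := chart_at_dom (iota z).
    rewrite -[LHS]mul1mx -(transitionK ad aiz dz diz) -!mulmxA; congr (_ *m _).
    by rewrite mulmxA -KE -mulmxA transitionK// mulmx1.
  rewrite gE// FrE// -(span_coord_mx (dlin _) (dinj _ dz)).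
  have [_ Lz] := frL _ (WV _ Wz).
  have := sL z Uz; have [[_ stz] spz] := (hnu, hN.2).
  move/(pullbackP (tangent_projP hiota hN z) (stz z) (spz z)).
  by rewrite Lz.
have [Q FQ] : exists Q, Fr (g p) *m Q = 1%:M.
  apply/row_freeP; rewrite gE// FrE// -(free_coord_mx (dlin _) (dinj _ dx)).
  by have [] := frL _ Vx.
have sFQ : smooth_on (chart_fwd c @` W) (fun y => Fr (g y) *m Q).
  by apply: smooth_mulmx => //; exact: smooth_cst.
have [|B [oB' Bp BA BU]] := unitmx_near oA Ap sFQ; first by rewrite FQ unitmx1.
(* l = f *m Fr near p, where Q is a right inverse of Fr (g p) *)
pose f y := l y *m Q *m invmx (Fr (g y) *m Q).
have sf : smooth_on B f.
  apply: smooth_mulmx => //; last first.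
    by apply: smooth_invmx => //; exact: smooth_on_sub sFQ.
  apply: smooth_mulmx => //; last exact: smooth_cst.
  exact: smooth_on_sub sl.
have fE y : B y -> f y *m Fr (g y) = l y.
  move=> By; have /submxP[e eE] := lFr y (BA y By).
  by rewrite /f eE -[e *m _ *m Q]mulmxA mulmxK//; exact: BU.
have df : differentiable f p by exact: smooth_differentiable sf Bp.
have Gp : G p *m K p = 1%:M by have [] := KP x U0x.
pose C := K p *m 'J f p.
pose ph w := f p + (w - g p) *m C.
have sph D : open D -> smooth_on D ph by exact: affine_smooth.
pose S y := \sum_i (ph (chart_fwd d y)) 0 i *: fr i y.
have genS y : chart_dom d y -> gen_in d y (S y) = ph (chart_fwd d y) *m Fr (chart_fwd d y).
  by move=> dy; rewrite FrE//; exact: coord_mx_comb.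
exists (V `&` chart_dom d), S; split.
- by apply: openI => //; exact: chart_dom_open.
- by split.
- apply: (@smooth_gen_chart _ _ _ _ d) => [||//|].
  + by apply: openI => //; exact: chart_dom_open.
  + by move=> y [].
  apply: (smooth_on_ext oB _ (smooth_mulmx oB (sph _ oB) sFr)) => _ [y [Vy dy] <-].
  by rewrite chart_fwdK// genS.
- move=> y [Vy dy]; have [_ ->] := frL y Vy.
  rewrite /= (span_coord_mx (dlin _) (dinj _ dy)) genS// FrE//.
  exact: submxMl.
have dg : differentiable g p by exact: smooth_differentiable sg Ap.
have [dph Dph] := affine_differentiable (f p) (g p) (g p) C.
have j1 : same_jet p (ph \o g) f.
  split=> //; first exact: differentiable_comp.
    by rewrite /ph /= subrr mul0mx addr0.
  move=> u; apply: (etrans (derive_comp_at Ap sg u dph)).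
  apply: (etrans (Dph _)); rewrite /C !mulmxA -[u *m _ *m K p]mulmxA Gp mulmx1.
  exact/esym/deriveEjacobian.
have j2 : same_jet p (fun y => ph (g y) *m Fr (g y)) l.
  have dFrg : differentiable (Fr \o g) p by exact: smooth_differentiable sFrg Ap.
  have j := same_jet_mulmx j1 (same_jet_refl dFrg).
  apply: (same_jet_trans j); apply: same_jet_near; first by case: j.
  by apply: (open_near oB' Bp) => y /fE.
have near_gen : \forall y \near p, ph (g y) *m Fr (g y) =
    gen_in d (chart_bwd d (g y)) (S (chart_bwd d (g y))).
  apply: (open_near oA Ap) => _ [z Wz <-]; rewrite gE//.
  by rewrite chart_fwdK ?genS//; exact: Wd.
have j3 : same_jet p (fun y => gen_in d (chart_bwd d (g y)) (S (chart_bwd d (g y)))) l.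
  have [dj _ _ _] := j2.
  exact: same_jet_trans (same_jet_sym (same_jet_near dj near_gen)) j2.
have E1 : (fun y => lsubmx (gen_in d (chart_bwd d (g y)) (S (chart_bwd d (g y))))) =
    loc_vec (iota x) (fun z => (S z).1) \o g.
  by apply/funext => y; rewrite /gen_in row_mxKl.
have E2 : (fun y => rsubmx (gen_in d (chart_bwd d (g y)) (S (chart_bwd d (g y))))) =
    loc_covec (iota x) (fun z => (S z).2) \o g.
  by apply/funext => y; rewrite /gen_in row_mxKr.
split.
  have E3 : (fun y => lsubmx (l y)) = (fun y => sv y *m G y).
    by apply/funext => y; rewrite /l row_mxKl.
  by have := same_jet_lsubmx j3; rewrite E1 E3.
have j4 : same_jet p (loc_covec (iota x) (fun z => (S z).2) \o g) (fun y => sc y *m (K y)^T).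
  have E3 : (fun y => rsubmx (l y)) = (fun y => sc y *m (K y)^T).
    by apply/funext => y; rewrite /l row_mxKr.
  by have := same_jet_rsubmx j3; rewrite E2 E3.
have dG : differentiable G p by exact: smooth_differentiable sG Ap.
have j5 := same_jet_mulmx j4 (same_jet_trmx (same_jet_refl dG)).
apply: same_jet_sym; apply: (same_jet_trans j5).
apply: same_jet_near; first by case: j5.
apply: (open_near oA Ap) => _ [z Wz <-].
have [_ U0z] := Wz; have [GK _] := KP z U0z.
rewrite -mulmxA -trmx_mul (_ : G _ *m K _ = 1%:M)// trmx1 mulmx1.
by [].
Qed.

(** Let S and T extend s and t to first order. The Courant bracket of S and T lies
    in L; its vector part is the image of that of s and t, and its covector part
    restricts to theirs, because brackets, Lie derivatives and differentials of
    fields that are related to first order are related. *)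
Lemma courant_mem (U : set N) (s t : N -> fibre R n) :
  open U -> U x -> smooth_gen U s -> smooth_gen U t ->
  (forall z, U z -> pullback L iota z (s z)) ->
  (forall z, U z -> pullback L iota z (t z)) ->
  pullback L iota x (courant s t x).
Proof.
move=> oU Ux ss st sL tL.
have [V1 [S [oV1 V1x sS SL [jSv jSc]]]] := extend_section oU Ux ss sL.
have [V2 [T [oV2 V2x sT TL [jTv jTc]]]] := extend_section oU Ux st tL.
pose V := V1 `&` V2.
have oV : open V by exact: openI.
have sSV : smooth_gen V S by apply: smooth_gen_sub sS => ? [].
have sTV : smooth_gen V T by apply: smooth_gen_sub sT => ? [].
have [_ _ cL] := hL.
have := cL V S T oV sSV sTV (fun y Vy => SL y Vy.1) (fun y Vy => TL y Vy.2)
  (iota x) (conj V1x V2x).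
pose A := chart_fwd c @` (U `&` (chart_dom c `&` iota @^-1` chart_dom d)).
have oA : open A.
  apply: chart_img_open_sub; last by move=> z [_ []].
  by apply: openI => //; exact: chart_preimage_open.
have Ap : A p by exists x.
have sg : smooth_on A g.
  by apply: smooth_loc => // z [_ []].
have gp : g p = chart_fwd d (iota x) by rewrite /g /p /= chart_fwdK.
have dxs (X : N -> 'rV[R]_n) : smooth_vec U X -> differentiable (loc_vec x X) p.
  by move=> /(_ c ac) h; apply: (smooth_differentiable h); exists x.
have dxc (a : N -> 'rV[R]_n) : smooth_covec U a -> differentiable (loc_covec x a) p.
  by move=> /(_ c ac) h; apply: (smooth_differentiable h); exists x.
have dys (X : M -> 'rV[R]_m) : smooth_vec V X -> differentiable (loc_vec (iota x) X) (g p).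
  by move=> /(_ d ad) h; apply: (smooth_differentiable h); exists (iota x).
have dyc (a : M -> 'rV[R]_m) : smooth_covec V a -> differentiable (loc_covec (iota x) a) (g p).
  by move=> /(_ d ad) h; apply: (smooth_differentiable h); exists (iota x).
have lv (X : N -> 'rV[R]_n) : loc_vec x X p = X x.
  by rewrite /loc_vec /p -/c chart_fwdK// vec_in_chart_at.
have lc (a : N -> 'rV[R]_n) : loc_covec x a p = a x.
  by rewrite /loc_covec /p -/c chart_fwdK// covec_in_chart_at.
have Lv (X : M -> 'rV[R]_m) : loc_vec (iota x) X (g p) = X (iota x).
  by rewrite gp /loc_vec -/d chart_fwdK// vec_in_chart_at.
have Lc (a : M -> 'rV[R]_m) : loc_covec (iota x) a (g p) = a (iota x).
  by rewrite gp /loc_covec -/d chart_fwdK// covec_in_chart_at.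
have [ssv ssc] := ss; have [stv stc] := st.
have [sSv sSc] := sSV; have [sTv sTc] := sTV.
have bracketE : lie_bracket (fun z => (s z).1) (fun z => (t z).1) x *m G p =
    lie_bracket (fun z => (S z).1) (fun z => (T z).1) (iota x).
  have := related_bracket oA Ap sg (dxs _ ssv) (dxs _ stv) (dys _ sSv) (dys _ sTv) jSv jTv.
  by rewrite !lv !Lv gp.
have lieE (X b : N -> 'rV[R]_n) (X' b' : M -> 'rV[R]_m) :
    smooth_vec U X -> smooth_vec V X' -> smooth_covec V b' ->
    same_jet p (loc_vec (iota x) X' \o g) (fun y => loc_vec x X y *m G y) ->
    same_jet p (loc_covec x b) (fun y => loc_covec (iota x) b' (g y) *m (G y)^T) ->
    lie_derivative X b x = lie_derivative X' b' (iota x) *m (G p)^T.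
  move=> sX sX' sb' jX jb.
  have := related_lie_derivative oA Ap sg (dxs _ sX) (dys _ sX') (dyc _ sb') jX jb.
  by rewrite !lv !Lv !lc !Lc gp.
pose h z := eval_covec (s z).2 (t z).1 - eval_covec (t z).2 (s z).1.
pose k z := eval_covec (S z).2 (T z).1 - eval_covec (T z).2 (S z).1.
pose k' y := eval_covec (loc_covec (iota x) (fun z => (S z).2) y)
    (loc_vec (iota x) (fun z => (T z).1) y) -
  eval_covec (loc_covec (iota x) (fun z => (T z).2) y)
    (loc_vec (iota x) (fun z => (S z).1) y).
pose h' y := eval_covec (loc_covec x (fun z => (s z).2) y)
    (loc_vec x (fun z => (t z).1) y) -
  eval_covec (loc_covec x (fun z => (t z).2) y)
    (loc_vec x (fun z => (s z).1) y).
have kE y : (chart_fwd d @` (V `&` chart_dom d)) y -> k' y = (k \o chart_bwd d) y.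
  move=> [z [_ dz] <-]; rewrite /k' /k /loc_covec /loc_vec -/d /= chart_fwdK//.
  by rewrite !eval_covec_in.
have hE y : (chart_fwd c @` (U `&` chart_dom c)) y -> h' y = (h \o chart_bwd c) y.
  move=> [z [_ cz] <-]; rewrite /h' /h /loc_covec /loc_vec -/c /= chart_fwdK//.
  by rewrite !eval_covec_in.
have oVd := @chart_img_nbhs_open _ _ _ d _ oV.
have oUc := @chart_img_nbhs_open _ _ _ c _ oU.
have Vgp : (chart_fwd d @` (V `&` chart_dom d)) (g p) by rewrite gp; exists (iota x).
have dk' : differentiable k' (g p).
  apply: differentiableB; apply: differentiable_pairing;
    by [exact: dyc|exact: dys].
have [dk _] := near_eq_diff (open_near oVd Vgp kE) dk'.
have jh : same_jet p h' (k' \o g).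
  have jst := related_pairing Ap sg (dxs _ stv) (dyc _ sSc) jTv jSc.
  have jts := related_pairing Ap sg (dxs _ ssv) (dyc _ sTc) jSv jTc.
  exact: same_jetB jst jts.
have jhk : same_jet p (h \o chart_bwd c) ((k \o chart_bwd d) \o g).
  have [dh' dkg _ _] := jh.
  have j1 : same_jet p h' (h \o chart_bwd c).
    by apply: same_jet_near => //; apply: (open_near oUc) hE; exists x.
  apply: (same_jet_trans (same_jet_sym j1)); apply: (same_jet_trans jh).
  apply: same_jet_near => //; have cg : {for p, continuous g}.
    by apply: differentiable_continuous; exact: smooth_differentiable sg Ap.
  have := open_near oVd Vgp kE; exact: cg.
have diffE : differential h x = differential k (iota x) *m (G p)^T.
  by have := related_differential Ap sg dk jhk; rewrite gp.
move=> CL; exists (courant s t x).1, (courant S T (iota x)).2; split.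
  have -> : tmap iota x (courant s t x).1 = (courant S T (iota x)).1.
    by rewrite tmapE; exact: bracketE.
  by rewrite -surjective_pairing.
rewrite cotmapE [LHS]surjective_pairing; congr pair.
rewrite /courant /= -/h -/k mulmxDl mulmxBl -scalemxAl -diffE.
congr (_ - _ + _); exact: lieE.
Qed.

End AtPoint.

Lemma pullback_dirac : dirac_structure (pullback L iota).
Proof.
split; first exact: pullback_subbundle hL hiota hN.
  exact: pullback_max_isotropic hL hiota hN.
by move=> U s t oU ss st sL tL x Ux; exact: courant_mem oU Ux ss st sL tL.
Qed.

End CourantClosed.

Theorem proposition4p1 (R : realType) (m n : nat)
  (M : manifold R m) (N : manifold R n)
  (L : M -> set (fibre R m)) (iota : N -> M) (nu : N -> set 'rV[R]_m)
  (hL : dirac_structure L) (hiota : embedding iota) (hnu : normal_bundle iota nu)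
  (hN : properly_normalized L iota nu) :
  [/\ proper_submanifold L iota,
      submersed_submanifold L iota nu,
      dirac_structure (pullback L iota) &
      pullback L iota = projected L iota nu].
Proof.
have E := pullback_eq_projected hiota hN.
have D := pullback_dirac hL hiota hN.
split=> //; last by split=> //; rewrite -E.
by exists n; case: D.
Qed.
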